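(* If a rational tangle has invariant $0$, then it is the untangle. Precisely: let $m_1,\dots,m_n\in\{T,R\}$ be a finite sequence of moves ($n\ge 0$), and let $\tau=m_n\cdot(\cdots(m_2\cdot(m_1\cdot\tau_0))\cdots)$ be the rational tangle it produces from the untangle $\tau_0$. If the tangle invariant $x\in\mathbb{Q}\cup\{\infty\}$ computed from this sequence of moves is equal to $0$, then $\tau=\tau_0$ (equality of tangles, i.e. up to isotopy).
   Context: Tangles. Let $B\subset\mathbb{R}^3$ be the closed unit ball, with the four marked boundary points $p_1=\tfrac{1}{\sqrt2}(-1,-1,0)$, $p_2=\tfrac1{\sqrt2}(1,-1,0)$, $p_3=\tfrac1{\sqrt2}(1,1,0)$, $p_4=\tfrac1{\sqrt2}(-1,1,0)$ (the corners of a square viewed from the positive $z$-direction, so ''over'' means larger $z$). A tangle is a union of two disjoint tame, properly embedded, unoriented and unlabeled arcs in $B$ whose set of endpoints is $\{p_1,p_2,p_3,p_4\}$, considered up to ambient isotopy of $B$ fixing $\partial B$ pointwise. The untangle $\tau_0$ is the tangle consisting of the two straight segments $p_1p_4$ and $p_2p_3$. Moves. (Twist $T$) The ends in positions $1$ and $2$ are exchanged, the end in position $1$ passing over the end in position $2$: for $s\in[0,1]$ put $q_1(s)=\tfrac1{\sqrt2}(-\cos\pi s,-1,\sin\pi s)$, $q_2(s)=\tfrac1{\sqrt2}(\cos\pi s,-1,-\sin\pi s)$, $q_3(s)=p_3$, $q_4(s)=p_4$; then $T\cdot\tau$ is the union of $\tfrac12\tau$ with the four arcs $\{\tfrac{1+s}{2}q_i(s):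 s\in[0,1]\}$, $i=1,2,3,4$. (Turn $R$) $R\cdot\tau$ is the image of $\tau$ under the rotation of $B$ by $90^\circ$ counterclockwise about the $z$-axis (viewed from the positive $z$-direction). A rational tangle is a tangle obtained from $\tau_0$ by a finite sequence of moves $T$ and $R$. Tangle invariant. Given a finite sequence of moves $m_1,\dots,m_n$ starting from $\tau_0$, the invariant of the resulting state is the element of $\mathbb{Q}\cup\{\infty\}$ obtained by starting from $x=0$ and successively applying, for each move in order, $x\mapsto x+1$ if the move is $T$ and $x\mapsto -1/x$ if the move is $R$, with the conventions $-1/0=\infty$, $-1/\infty=0$, $\infty+1=\infty$. It is regarded as an invariant of the sequence of moves (well-definedness as an invariant of the tangle is not assumed). *)

(* Defs.v *)
From HB Require Import structures.
From mathcomp Require Import all_boot all_order all_algebra.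
From mathcomp Require Import all_classical all_reals all_analysis.

Set Implicit Arguments.
Unset Strict Implicit.
Unset Printing Implicit Defensive.

Import Order.TTheory GRing.Theory Num.Theory.
Import numFieldNormedType.Exports.

Local Open Scope classical_set_scope.
Local Open Scope ring_scope.

(* The library's norm on a product is the sup norm, so the round ball and
   sphere are given by the sum of the squares of the coordinates. *)
Definition sqnorm (R : realType) (v : R * R * R) : R :=
  v.1.1 ^+ 2 + v.1.2 ^+ 2 + v.2 ^+ 2.

Definition unit_ball (R : realType) : set (R * R * R) := [set v | sqnorm v <= 1].

Definition unit_sphere (R : realType) : set (R * R * R) := [set v | sqnorm v = 1].

Definition point1 (R : realType) : R * R * R := (Num.sqrt 2)^-1 *: (-1, -1, 0).
Definition point2 (R : realType) : R * R * R := (Num.sqrt 2)^-1 *: (1, -1, 0).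
Definition point3 (R : realType) : R * R * R := (Num.sqrt 2)^-1 *: (1, 1, 0).
Definition point4 (R : realType) : R * R * R := (Num.sqrt 2)^-1 *: (-1, 1, 0).

Definition segment (R : realType) (a b : R * R * R) : set (R * R * R) :=
  [set a + t *: (b - a) | t in `[0, 1]].

Definition ball_homeomorphism (R : realType) (h : R * R * R -> R * R * R) : Prop :=
  exists g : R * R * R -> R * R * R,
    [/\ {within @unit_ball R, continuous h},
        {within @unit_ball R, continuous g},
        forall v, unit_ball v -> unit_ball (h v) /\ g (h v) = v &
        forall v, unit_ball v -> unit_ball (g v) /\ h (g v) = v].

Definition polygonal (R : realType) (A : set (R * R * R)) : Prop :=
  exists s : seq ((R * R * R) * (R * R * R)),
    A = \bigcup_(ab in [set` s]) segment ab.1 ab.2.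

(* Straightening by a homeomorphism of the pair (ball, sphere), and not merely
   of the ambient space, excludes wildness at the endpoints relative to the
   sphere as well as in the interior of the ball. *)
Definition tame (R : realType) (A : set (R * R * R)) : Prop :=
  exists2 h : R * R * R -> R * R * R, ball_homeomorphism h & polygonal (h @` A).

Definition proper_arc (R : realType) (c : R -> R * R * R) : Prop :=
  [/\ {within `[0, 1], continuous c},
      {in `[0, 1] &, injective c},
      forall t : R, t \in `[0, 1] -> unit_ball (c t) &
      forall t : R, t \in `[0, 1] -> (unit_sphere (c t) <-> t = 0 \/ t = 1)].

Definition is_tangle (R : realType) (A : set (R * R * R)) : Prop :=
  exists c d : R -> R * R * R,
    let C := c @` `[0, 1] in let D := d @` `[0, 1] in
    [/\ proper_arc c /\ proper_arc d,
        tame C /\ tame D,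
        C `&` D = set0,
        [set c 0; c 1; d 0; d 1] = [set point1 R; point2 R; point3 R; point4 R] &
        A = C `|` D].

Definition isotopic (R : realType) (A A' : set (R * R * R)) : Prop :=
  exists H : R * (R * R * R) -> R * R * R,
    [/\ {within `[0, 1] `*` @unit_ball R, continuous H},
        forall t : R, t \in `[0, 1] -> ball_homeomorphism (fun v => H (t, v)),
        forall (t : R) v, t \in `[0, 1] -> unit_sphere v -> H (t, v) = v,
        forall v, unit_ball v -> H (0, v) = v &
        (fun v => H (1, v)) @` A = A'].

(* A tangle up to isotopy is the set of all its representatives, so that
   equality of tangles is equality of these sets. *)
Definition tangle_class (R : realType) (A : set (R * R * R)) :
    set (set (R * R * R)) :=
  [set A' | is_tangle A' /\ isotopic A A'].

Definition untangle (R : realType) : set (R * R * R) :=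
  segment (point1 R) (point4 R) `|` segment (point2 R) (point3 R).

Arguments untangle : clear implicits.

Definition twist_end1 (R : realType) (s : R) : R * R * R :=
  (Num.sqrt 2)^-1 *: (- cos (pi * s), -1, sin (pi * s)).
Definition twist_end2 (R : realType) (s : R) : R * R * R :=
  (Num.sqrt 2)^-1 *: (cos (pi * s), -1, - sin (pi * s)).
Definition twist_end3 (R : realType) (s : R) : R * R * R := point3 R.
Definition twist_end4 (R : realType) (s : R) : R * R * R := point4 R.

Definition shell_arc (R : realType) (q : R -> R * R * R) : set (R * R * R) :=
  [set ((1 + s) / 2) *: q s | s in `[0, 1]].

Definition twist (R : realType) (A : set (R * R * R)) : set (R * R * R) :=
  [set 2^-1 *: v | v in A]
    `|` (shell_arc (@twist_end1 R) `|` shell_arc (@twist_end2 R)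
         `|` shell_arc (@twist_end3 R) `|` shell_arc (@twist_end4 R)).

Definition turn (R : realType) (A : set (R * R * R)) : set (R * R * R) :=
  [set (- v.1.2, v.1.1, v.2) | v in A].

Inductive move := Twist | Turn.

Definition move_rep (R : realType) (m : move) (A : set (R * R * R)) :
    set (R * R * R) :=
  match m with Twist => twist A | Turn => turn A end.

Definition move_class (R : realType) (m : move) (C : set (set (R * R * R))) :
    set (set (R * R * R)) :=
  \bigcup_(A in C) tangle_class (move_rep m A).

Definition rational_tangle (R : realType) (ms : seq move) :
    set (set (R * R * R)) :=
  foldl (fun C m => move_class m C) (tangle_class (untangle R)) ms.

Arguments rational_tangle : clear implicits.

(* In [option rat], [None] is the point at infinity. *)
Definition invariant_step (x : option rat) (m : move) : option rat :=
  match m, x with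
  | Twist, Some y => Some (y + 1)
  | Twist, None => None
  | Turn, Some y => if y == 0 then None else Some (- y^-1)
  | Turn, None => Some 0
  end.

Definition tangle_invariant (ms : seq move) : option rat :=
  foldl invariant_step (Some 0) ms.

(* Main.v *)
Require Import Defs.
From mathcomp Require Import all_boot all_order all_algebra.
From mathcomp Require Import all_classical all_reals all_analysis.
From mathcomp Require Import ring lra.

(** Up to isotopy fixing the sphere, the image of the untangle under a
homeomorphism of the ball depends only on the values of the homeomorphism on
the sphere: two homeomorphisms that agree there differ by one that is the
identity on the sphere, and the Alexander trick ([rel_auto_isotopic]) joins it
to the identity.  So the tangle made by a word of moves can be computed as
[h @` untangle R], where h is a composite of one convenient homeomorphism of
the ball for each move.

The convenient homeomorphisms come from the pillowcase.  The map
P(X, Y) = (cos X, cos Y, sin X sin Y) identifies the quotient of the plane by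
the signs and the translations in 2 pi Z^2 with a topological sphere that is
star-shaped around the origin, and its four cone points lie in the directions
of the marked points.  In these coordinates the quarter turn is
(X, Y) |-> (pi - Y, X), and (X, Y) |-> (X - Y, Y) is a half twist of the first
two marked points.  Extended radially to the ball ([pillow_twist]), the latter
stands for the move T, and the composite h of a word acts as an affine map
with a linear part M in SL_2(Z) and a translation in pi Z^2.  The second
column of M transforms like the invariant, which equals - M12 / M22
([word_pillow]).  If the invariant is 0, then M is lower triangular with
diagonal entries 1 or -1.  The strands of the untangle lie in the cone over
the lines X = 0 and X = pi, at a radius that is even in cos Y; hence h maps
the untangle exactly onto itself.

What remains is that T is isotopic to [pillow_twist] ([move_cone]).  Write
[add_spokes A] for the half-size copy of A joined to the marked points by
radial segments.  For the untangle this is the image under a homeomorphism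
fixing the sphere ([pinch_untangle]), and images of the untangle under radially
extended maps inherit this.  The move T is the image of [add_spokes A] under a
homeomorphism that is the identity on the inner half ball and turns the spokes
along the prescribed circular arcs; it has to be chosen so that it agrees with
[pillow_twist] on the sphere.  The obvious choice, a rotation about the y-axis
by an angle depending on the latitude and the radius, has other values on the
sphere, because [pillow_twist] slides along ellipses and not along circles.
Therefore [twist_map] precedes this rotation by the traces of two isotopies of
the sphere that fix the marked points: one makes the ellipses of the
middle latitudes round, the other deforms the angle function.  Both live in
the outer half of the ball and preserve the spokes. *)

Set Implicit Arguments.
Unset Strict Implicit.
Unset Printing Implicit Defensive.

Import Order.TTheory GRing.Theory Num.Theory.
Import numFieldNormedType.Exports.

Local Open Scope classical_set_scope.
Local Open Scope ring_scope.

(** * Continuity at a point *)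

(** The [ct] lemmas are closure properties of continuity at a point, stated for
functions given by an explicit formula, so that [ctac] can follow the syntax of
the formula. *)
Lemma ctpair (T U W : topologicalType) (f : T -> U) (g : T -> W) x :
  {for x, continuous f} -> {for x, continuous g} ->
  {for x, continuous (fun v => (f v, g v))}.
Proof.
move=> cf cg; rewrite /prop_for /continuous_at.
by apply: cvg_pair; [exact: cf|exact: cg].
Qed.

Section Continuity.
Variables (R : realType) (T : topologicalType).
Implicit Types (f g h : T -> R) (F G : T -> R * R * R).

Lemma ctC (c : R) x : {for x, continuous (fun _ : T => c)}.
Proof. exact: cvg_cst. Qed.

Lemma ctD f g x : {for x, continuous f} -> {for x, continuous g} ->
  {for x, continuous (fun v => f v + g v)}.
Proof. exact: cvgD. Qed.

Lemma ctN f x : {for x, continuous f} -> {for x, continuous (fun v => - f v)}.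
Proof. exact: cvgN. Qed.

Lemma ctM f g x : {for x, continuous f} -> {for x, continuous g} ->
  {for x, continuous (fun v => f v * g v)}.
Proof. exact: cvgM. Qed.

Lemma ctX f n x : {for x, continuous f} -> {for x, continuous (fun v => f v ^+ n)}.
Proof.
move=> cf; elim: n => [|n IH]; first exact: cvg_cst.
rewrite /prop_for /continuous_at exprS; under eq_fun do rewrite exprS.
exact: cvgM.
Qed.

Lemma ctV f x : f x != 0 -> {for x, continuous f} ->
  {for x, continuous (fun v => (f v)^-1)}.
Proof. exact: continuousV. Qed.

Lemma ctmax f g x : {for x, continuous f} -> {for x, continuous g} ->
  {for x, continuous (fun v => Num.max (f v) (g v))}.
Proof. exact: continuous_max. Qed.

Lemma ctmin f g x : {for x, continuous f} -> {for x, continuous g} ->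
  {for x, continuous (fun v => Num.min (f v) (g v))}.
Proof. exact: continuous_min. Qed.

Lemma ctabs f x : {for x, continuous f} -> {for x, continuous (fun v => `|f v|)}.
Proof. exact: cvg_norm. Qed.

Lemma ctsqrt f x : {for x, continuous f} ->
  {for x, continuous (fun v => Num.sqrt (f v))}.
Proof. by move=> cf; apply: continuous_comp cf _; exact: sqrt_continuous. Qed.

Lemma ctcos f x : {for x, continuous f} -> {for x, continuous (fun v => cos (f v))}.
Proof. by move=> cf; apply: continuous_comp cf _; exact: continuous_cos. Qed.

Lemma ctsin f x : {for x, continuous f} -> {for x, continuous (fun v => sin (f v))}.
Proof. by move=> cf; apply: continuous_comp cf _; exact: continuous_sin. Qed.

Lemma ct_squeeze f g x : g x = 0 -> (forall v, `|f v| <= g v) ->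
  {for x, continuous g} -> {for x, continuous f}.
Proof.
move=> gx0 fg cg.
have fx0 : f x = 0 by apply/eqP; rewrite -normr_le0 -gx0.
have cg0 : g v @[v --> x] --> (0 : R) by rewrite -gx0; exact: cg.
have cN0 : - g v @[v --> x] --> (0 : R) by rewrite -oppr0; exact: cvgN.
rewrite /prop_for /continuous_at fx0.
have gfg : \forall v \near x, - g v <= f v <= g v.
  by apply: nearW => v; rewrite -ler_norml.
exact: (squeeze_cvgr gfg cN0 cg0).
Qed.

Lemma ct1 F x : {for x, continuous F} -> {for x, continuous (fun v => (F v).1.1)}.
Proof.
move=> cF; apply: (@continuous_comp _ _ _ F (fun p : R * R * R => p.1.1) x cF).
apply: (@continuous_comp _ _ _ (fun p : R * R * R => p.1) (fun q : R * R => q.1));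
  exact: cvg_fst.
Qed.

Lemma ct2 F x : {for x, continuous F} -> {for x, continuous (fun v => (F v).1.2)}.
Proof.
move=> cF; apply: (@continuous_comp _ _ _ F (fun p : R * R * R => p.1.2) x cF).
apply: (@continuous_comp _ _ _ (fun p : R * R * R => p.1) (fun q : R * R => q.2));
  [exact: cvg_fst|exact: cvg_snd].
Qed.

Lemma ct3 F x : {for x, continuous F} -> {for x, continuous (fun v => (F v).2)}.
Proof.
move=> cF; apply: (@continuous_comp _ _ _ F (fun p : R * R * R => p.2) x cF).
exact: cvg_snd.
Qed.

Lemma ctP f g h x : {for x, continuous f} -> {for x, continuous g} ->
  {for x, continuous h} -> {for x, continuous (fun v => (f v, g v, h v))}.
Proof. by move=> cf cg ch; apply: ctpair ch; apply: ctpair. Qed.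

Lemma ct_coords F x : {for x, continuous (fun v => (F v).1.1)} ->
  {for x, continuous (fun v => (F v).1.2)} ->
  {for x, continuous (fun v => (F v).2)} -> {for x, continuous F}.
Proof.
move=> c1 c2 c3.
have -> : F = fun v => ((F v).1.1, (F v).1.2, (F v).2).
  by apply/funext => v; case: (F v) => [[? ?] ?].
exact: ctP.
Qed.

Lemma ctZv f F x : {for x, continuous f} -> {for x, continuous F} ->
  {for x, continuous (fun v => f v *: F v)}.
Proof. exact: cvgZ. Qed.

Lemma ctDv F G x : {for x, continuous F} -> {for x, continuous G} ->
  {for x, continuous (fun v => F v + G v)}.
Proof. exact: cvgD. Qed.

Lemma ctNv F x : {for x, continuous F} -> {for x, continuous (fun v => - F v)}.
Proof. exact: cvgN. Qed.

Lemma ctcomp (h : R * R * R -> R * R * R) F x : continuous h ->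
  {for x, continuous F} -> {for x, continuous (fun v => h (F v))}.
Proof. by move=> ch cF; apply: continuous_comp cF _; exact: ch. Qed.

End Continuity.

Lemma ctid (T : topologicalType) (x : T) : {for x, continuous (fun v : T => v)}.
Proof. exact: cvg_id. Qed.

Ltac ctac :=
  cbv beta;
  lazymatch goal with
  | H : ?G |- ?G => exact: H
  | |- {for _, continuous ?F} =>
    lazymatch F with
    | (fun _ => ?c) => exact: ctC
    | (fun v => v) => exact: ctid
    | (fun v => @?f v + @?g v) => apply: (@ctD _ _ f g); ctac
    | (fun v => - @?f v) => apply: (@ctN _ _ f); ctac
    | (fun v => @?f v * @?g v) => apply: (@ctM _ _ f g); ctac
    | (fun v => @?f v ^+ _) => apply: (@ctX _ _ f); ctac
    | (fun v => Num.max (@?f v) (@?g v)) => apply: (@ctmax _ _ f g); ctac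
    | (fun v => Num.min (@?f v) (@?g v)) => apply: (@ctmin _ _ f g); ctac
    | (fun v => `|@?f v|) => apply: (@ctabs _ _ f); ctac
    | (fun v => Num.sqrt (@?f v)) => apply: (@ctsqrt _ _ f); ctac
    | (fun v => cos (@?f v)) => apply: (@ctcos _ _ f); ctac
    | (fun v => sin (@?f v)) => apply: (@ctsin _ _ f); ctac
    | (fun v => (@?f v).1.1) => apply: (@ct1 _ _ f); ctac
    | (fun v => (@?f v).1.2) => apply: (@ct2 _ _ f); ctac
    | (fun v => (@?f v).2) => apply: (@ct3 _ _ f); ctac
    | (fun v => (@?f v, @?g v, @?h v)) => apply: (@ctP _ _ f g h); ctac
    | _ => idtac
    end
  | _ => idtac
  end.

(** * The Euclidean norm and the radial retraction *)
Section Norm.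
Variable R : realType.
Implicit Types (u v w : R * R * R) (a t : R).

Definition enorm v := Num.sqrt (sqnorm v).

Lemma sqnorm_ge0 v : 0 <= sqnorm v.
Proof. by rewrite /sqnorm !addr_ge0 ?sqr_ge0. Qed.

Lemma enorm_ge0 v : 0 <= enorm v.
Proof. exact: sqrtr_ge0. Qed.

Lemma sqr_enorm v : enorm v ^+ 2 = sqnorm v.
Proof. by rewrite /enorm sqr_sqrtr ?sqnorm_ge0. Qed.

Lemma sqnormZ a v : sqnorm (a *: v) = a ^+ 2 * sqnorm v.
Proof. by case: v => [[x y] z]; rewrite /sqnorm /= /GRing.scale /=; ring. Qed.

Lemma enormZ a v : enorm (a *: v) = `|a| * enorm v.
Proof. by rewrite /enorm sqnormZ sqrtrM ?sqr_ge0// sqrtr_sqr. Qed.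

Lemma unit_ballP v : unit_ball v <-> enorm v <= 1.
Proof.
rewrite /unit_ball/= -sqr_enorm; split => [h|h].
  by rewrite -(@ler_pXn2r _ 2)// ?nnegrE ?enorm_ge0// expr1n.
by rewrite expr_le1 ?enorm_ge0.
Qed.

Lemma unit_sphereP v : unit_sphere v <-> enorm v = 1.
Proof.
rewrite /unit_sphere/= -sqr_enorm; split => [/eqP|->]; last by rewrite expr1n.
by rewrite sqrf_eq1 => /orP[/eqP//|/eqP h]; have := enorm_ge0 v; rewrite h; lra.
Qed.

Lemma enorm_eq0 v : enorm v = 0 -> v = 0.
Proof.
move=> h; have := sqr_enorm v; rewrite h expr0n/= /sqnorm => /esym/eqP.
rewrite !paddr_eq0 ?addr_ge0 ?sqr_ge0// !sqrf_eq0.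
by case: v {h} => [[x y] z] /= /andP[/andP[/eqP-> /eqP->] /eqP->].
Qed.

Lemma enorm0 : enorm 0 = 0.
Proof. by rewrite /enorm /sqnorm /= !expr0n/= !addr0 sqrtr0. Qed.

Lemma enorm_gt0 v : v <> 0 -> 0 < enorm v.
Proof.
move=> v0; rewrite lt_neqAle enorm_ge0 andbT eq_sym; apply/eqP => h.
exact/v0/enorm_eq0.
Qed.

Lemma coord_le_enorm v :
  [/\ `|v.1.1| <= enorm v, `|v.1.2| <= enorm v & `|v.2| <= enorm v].
Proof.
have p1 := sqr_ge0 v.1.1; have p2 := sqr_ge0 v.1.2; have p3 := sqr_ge0 v.2.
by split; rewrite -sqrtr_sqr /enorm ler_wsqrtr// /sqnorm; lra.
Qed.

Lemma continuous_enorm : continuous enorm.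
Proof.
move=> v.
suff : {for v, continuous (fun v : R * R * R =>
    Num.sqrt (v.1.1 ^+ 2 + v.1.2 ^+ 2 + v.2 ^+ 2))} by [].
by ctac.
Qed.

Lemma ctenorm (T : topologicalType) (F : T -> R * R * R) x :
  {for x, continuous F} -> {for x, continuous (fun s => enorm (F s))}.
Proof. by move=> cF; apply: continuous_comp cF _; exact: continuous_enorm. Qed.

(** Radial formulas divide by the norm; continuity at the centre of the ball
comes for free from this lemma. *)
Lemma norm_preserving_ct0 (h : R * R * R -> R * R * R) :
  (forall v, enorm (h v) = enorm v) -> {for 0, continuous h}.
Proof.
move=> hn.
have sq (f : R * R * R -> R) : (forall v, `|f v| <= enorm v) ->
    {for (0 : R * R * R), continuous f}.
  by move=> fn; apply: ct_squeeze enorm0 fn _; exact: continuous_enorm.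
by apply: ct_coords; apply: sq => v; rewrite -hn;
  case: (coord_le_enorm (h v)).
Qed.

(** Composition with this retraction turns maps that are continuous on the ball
into maps that are continuous everywhere, so subspace topologies can be
avoided from here on. *)
Definition retr v := (Num.max 1 (enorm v))^-1 *: v.

Lemma retr_id v : enorm v <= 1 -> retr v = v.
Proof. by move=> h; rewrite /retr max_l// invr1 scale1r. Qed.

Lemma enorm_retr_big v : 1 <= enorm v -> enorm (retr v) = 1.
Proof.
move=> h; rewrite /retr max_r// enormZ ger0_norm ?invr_ge0 ?enorm_ge0//.
by rewrite mulVf// gt_eqF// (lt_le_trans ltr01).
Qed.

Lemma enorm_retr v : enorm (retr v) <= 1.
Proof.
by case: (leP (enorm v) 1) => h; [rewrite retr_id|rewrite enorm_retr_big// ltW].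
Qed.

Lemma continuous_retr : continuous retr.
Proof.
move=> v.
suff : {for v, continuous (fun v : R * R * R => (Num.max 1 (enorm v))^-1 *: v)}.
  by [].
apply: ctZv; last exact: ctid.
apply: ctV; first by rewrite gt_eqF// lt_max ltr01.
by ctac; exact: continuous_enorm.
Qed.

End Norm.

(** * Homeomorphisms of the ball and the Alexander trick *)
Section RelativeHomeomorphisms.
Variable R : realType.
Implicit Types (u v w : R * R * R) (A B : set (R * R * R)).
Implicit Types (h g k : R * R * R -> R * R * R).

Definition ball_auto h g := [/\ continuous h, continuous g,
  forall v, enorm v <= 1 -> enorm (h v) <= 1 /\ g (h v) = v &
  forall v, enorm v <= 1 -> enorm (g v) <= 1 /\ h (g v) = v].

Definition rel_auto k :=
  exists2 g, ball_auto k g & forall v, enorm v = 1 -> k v = v.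

Definition in_ball A := forall v, A v -> enorm v <= 1.

Lemma ball_auto_sym h g : ball_auto h g -> ball_auto g h.
Proof. by case. Qed.

Lemma ball_auto_comp h g h' g' : ball_auto h g -> ball_auto h' g' ->
  ball_auto (h' \o h) (g \o g').
Proof.
move=> [ch cg hg gh] [ch' cg' hg' gh']; split.
- by move=> v; apply: continuous_comp; [exact: ch|exact: ch'].
- by move=> v; apply: continuous_comp; [exact: cg'|exact: cg].
- move=> v /hg[hv ghv]; have [h'v gh'v] := hg' _ hv.
  by rewrite /= gh'v.
- move=> v /gh'[hv ghv]; have [h'v gh'v] := gh _ hv.
  by rewrite /= gh'v.
Qed.

Lemma ball_auto_homeo h g : ball_auto h g -> ball_homeomorphism h.
Proof.
move=> [ch cg hg gh]; exists g; split.
- exact: continuous_subspaceT.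
- exact: continuous_subspaceT.
- by move=> v /unit_ballP /hg[? ?]; split=> //; apply/unit_ballP.
- by move=> v /unit_ballP /gh[? ?]; split=> //; apply/unit_ballP.
Qed.

Lemma continuous_extend h : {within @unit_ball R, continuous h} ->
  continuous (h \o @retr R).
Proof.
move=> /subspace_continuousP ch v.
have bv : unit_ball (retr v) by apply/unit_ballP; exact: enorm_retr.
have cr : retr u @[u --> v] --> within (@unit_ball R) (nbhs (retr v)).
  move=> S WS; have W : nbhs (retr v) [set u | unit_ball u -> S u] by exact: WS.
  suff : nbhs v (@retr R @^-1` S) by [].
  have : nbhs v (@retr R @^-1` [set u | unit_ball u -> S u]) by exact: continuous_retr W.
  by apply: filterS => u /= Su; apply: Su; apply/unit_ballP; exact: enorm_retr.
exact: cvg_comp cr (ch _ bv).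
Qed.

Lemma ball_auto_of_homeo h : ball_homeomorphism h ->
  exists h' g', ball_auto h' g' /\ forall v, enorm v <= 1 -> h' v = h v.
Proof.
move=> [g [ch cg hg gh]].
exists (h \o @retr R), (g \o @retr R); split; last first.
  by move=> v v1; rewrite /= retr_id.
split; [exact: continuous_extend|exact: continuous_extend| |].
- move=> v v1; have /hg[/unit_ballP b e] : unit_ball v by apply/unit_ballP.
  by rewrite /= (retr_id v1) (retr_id b).
- move=> v v1; have /gh[/unit_ballP b e] : unit_ball v by apply/unit_ballP.
  by rewrite /= (retr_id v1) (retr_id b).
Qed.

Lemma ball_auto_inv_fix h g v : ball_auto h g -> enorm v = 1 -> h v = v ->
  g v = v.
Proof.
by move=> [_ _ hg _] v1 hv; rewrite -{1}hv; case: (hg v _) => //; rewrite v1.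
Qed.

Lemma rel_auto_comp k k' : rel_auto k -> rel_auto k' -> rel_auto (k' \o k).
Proof.
move=> [g kg kf] [g' kg' kf']; exists (g \o g'); first exact: ball_auto_comp.
by move=> v v1; rewrite /= kf// kf'.
Qed.

Lemma rel_auto_inv k A : rel_auto k -> in_ball A ->
  exists2 g, rel_auto g & g @` (k @` A) = A.
Proof.
move=> [g kg kf] Ab; exists g.
  exists k; first exact: ball_auto_sym.
  by move=> v v1; apply: ball_auto_inv_fix kg _ _ => //; exact: kf.
have [_ _ gk _] := kg.
apply/seteqP; split=> [_ [_ [v Av <-] <-]|v Av].
  by have [_ ->] := gk _ (Ab _ Av).
by exists (k v); [exists v|have [_ ->] := gk _ (Ab _ Av)].
Qed.

Lemma in_ball_image h g A : ball_auto h g -> in_ball A -> in_ball (h @` A).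
Proof. by move=> [_ _ hg _] Ab _ [v /Ab/hg[? _] <-]. Qed.

Section Alexander.
Variables (k g : R * R * R -> R * R * R).

(** The Alexander isotopy [t k(v / t)] for [|v| <= t], and [v] beyond, in one
formula: outside the ball of radius [t] the retraction lands on the sphere,
where [k] is the identity, and the bracket vanishes. *)
Definition alexander (p : R * (R * R * R)) : R * R * R :=
  p.2 + p.1 *: (k (retr (p.1^-1 *: p.2)) - retr (p.1^-1 *: p.2)).

Hypothesis kg : ball_auto k g.
Hypothesis kfix : forall v, enorm v = 1 -> k v = v.

Lemma alexander_continuous : continuous alexander.
Proof.
have [ck _ kb _] := kg.
move=> [t v]; have [->|t0] := eqVneq t 0.
- suff : {for (0, v), continuous (fun p : R * (R * R * R) =>
    p.2 + p.1 *: (k (retr (p.1^-1 *: p.2)) - retr (p.1^-1 *: p.2)))} by [].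
  apply: ctDv; first exact: cvg_snd.
  (* At [t = 0] the correction term is at most [2 t], whatever [v] is. *)
  have c0 : {for (0, v), continuous (fun p : R * (R * R * R) => `|p.1| * 2)}.
    by apply: ctM; [apply: ctabs; exact: cvg_fst|exact: ctC].
  have bd (p : R * (R * R * R)) (a b : R) :
      `|a| <= 1 -> `|b| <= 1 -> `|p.1 * (a - b)| <= `|p.1| * 2.
    by move=> a1 b1; rewrite normrM ler_wpM2l// (le_trans (ler_normB _ _)); lra.
  have c1 u : enorm u <= 1 -> [/\ `|u.1.1| <= 1, `|u.1.2| <= 1 & `|u.2| <= 1].
    by move=> u1; case: (coord_le_enorm u) => *; split; apply: le_trans u1.
  have rr p := c1 _ (enorm_retr p).
  have kr p := c1 _ (kb _ (enorm_retr p)).1.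
  apply: ct_coords;
    (apply: (ct_squeeze (g := fun p : R * (R * R * R) => `|p.1| * 2)) => //;
       [by rewrite /= normr0 mul0r|move=> p; apply: bd]);
    by [case: (kr (p.1^-1 *: p.2))|case: (rr (p.1^-1 *: p.2))].
- suff : {for (t, v), continuous (fun p : R * (R * R * R) =>
    p.2 + p.1 *: (k (retr (p.1^-1 *: p.2)) - retr (p.1^-1 *: p.2)))} by [].
  have cr : {for (t, v), continuous (fun p : R * (R * R * R) =>
      retr (p.1^-1 *: p.2))}.
    apply: ctcomp; first exact: continuous_retr.
    apply: ctZv; last exact: cvg_snd.
    by apply: ctV; [exact: t0|exact: cvg_fst].
  apply: ctDv; first exact: cvg_snd.
  apply: ctZv; first exact: cvg_fst.
  by apply: ctDv; [exact: ctcomp|exact: ctNv].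
Qed.

Lemma alexander_small t v : 0 < t -> enorm v <= t ->
  alexander (t, v) = t *: k (t^-1 *: v).
Proof.
move=> t0 vt; rewrite /alexander/= retr_id; last first.
  by rewrite enormZ gtr0_norm ?invr_gt0// ler_pdivrMl// mulr1.
by rewrite scalerBr scalerA divff ?gt_eqF// scale1r addrC subrK.
Qed.

Lemma alexander_big t v : 0 < t -> t <= enorm v -> alexander (t, v) = v.
Proof.
move=> t0 vt; rewrite /alexander/= kfix ?subrr ?scaler0 ?addr0//.
by apply: enorm_retr_big; rewrite enormZ gtr0_norm ?invr_gt0// ler_pdivlMl// mulr1.
Qed.

Lemma alexander0 v : alexander (0, v) = v.
Proof. by rewrite /alexander/= scale0r addr0. Qed.

Lemma alexander1 v : enorm v <= 1 -> alexander (1, v) = k v.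
Proof. by move=> v1; rewrite alexander_small// invr1 !scale1r. Qed.

End Alexander.

Lemma alexanderK k g t v : ball_auto k g -> (forall v, enorm v = 1 -> k v = v) ->
  0 <= t <= 1 -> enorm v <= 1 ->
  enorm (alexander k (t, v)) <= 1 /\ alexander g (t, alexander k (t, v)) = v.
Proof.
move=> kg kf /andP[t0 t1] v1.
have gf w : enorm w = 1 -> g w = w.
  by move=> w1; apply: (ball_auto_inv_fix kg) => //; exact: kf.
have [->|tn] := eqVneq t 0; first by rewrite !alexander0; split.
have tp : 0 < t by rewrite lt_neqAle eq_sym tn.
have [vt|/ltW tv] := leP (enorm v) t; last first.
  by rewrite !alexander_big//; split.
have [_ _ kb _] := kg.
have v'1 : enorm (t^-1 *: v) <= 1.
  by rewrite enormZ gtr0_norm ?invr_gt0// ler_pdivrMl// mulr1.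
have [k1 gk] := kb _ v'1.
have b : enorm (t *: k (t^-1 *: v)) <= t.
  by rewrite enormZ gtr0_norm// ger_pMr.
rewrite (alexander_small _ tp vt); split; first exact: (le_trans b t1).
by rewrite alexander_small// scalerA mulVf// scale1r gk scalerA mulfV// scale1r.
Qed.

Lemma alexander_auto k g t : ball_auto k g -> (forall v, enorm v = 1 -> k v = v) ->
  0 <= t <= 1 ->
  ball_auto (fun v => alexander k (t, v)) (fun v => alexander g (t, v)).
Proof.
move=> kg kf t01.
have gf w : enorm w = 1 -> g w = w.
  by move=> w1; apply: (ball_auto_inv_fix kg) => //; exact: kf.
have slice h : continuous (alexander h) -> continuous (fun v => alexander h (t, v)).
  move=> ch v; apply: (@continuous_comp _ _ _ (fun v => (t, v)) (alexander h)).
    by apply: ctpair; [exact: ctC|exact: ctid].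
  exact: ch.
have gk := ball_auto_sym kg.
split; [exact/slice/alexander_continuous/kg|exact/slice/alexander_continuous/gk| |].
  by move=> v v1; exact: alexanderK.
by move=> v v1; exact: alexanderK.
Qed.

Lemma alexander_fix k t v : (forall v, enorm v = 1 -> k v = v) ->
  0 <= t <= 1 -> enorm v = 1 -> alexander k (t, v) = v.
Proof.
move=> kf /andP[t0 t1] v1; have [->|tn] := eqVneq t 0; first exact: alexander0.
by apply: alexander_big; rewrite ?v1// lt_neqAle eq_sym tn.
Qed.

(** With its converse [isotopic_rel_auto], this removes the time parameter:
isotopy of tangles means equality up to [rel_auto]. *)
Lemma rel_auto_isotopic k A : rel_auto k -> in_ball A -> isotopic A (k @` A).
Proof.
move=> [g kg kf] Ab; exists (alexander k); split.
- exact/continuous_subspaceT/alexander_continuous/kg.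
- move=> t; rewrite in_itv/= => t01.
  exact: ball_auto_homeo (alexander_auto kg kf t01).
- move=> t v; rewrite in_itv/= => t01 /unit_sphereP; exact: alexander_fix.
- by move=> v _; exact: alexander0.
- by apply/seteqP; split=> [_ [v Av <-]|_ [v Av <-]]; exists v => //;
    rewrite alexander1//; exact: Ab.
Qed.

Lemma isotopic_rel_auto A B : in_ball A -> isotopic A B ->
  exists2 k, rel_auto k & B = k @` A.
Proof.
move=> Ab [H [_ hom fixs _ <-]].
have [|k [g [kg kH]]] := ball_auto_of_homeo (hom 1 _).
  by rewrite in_itv/= ler01 lexx.
exists k.
  exists g => // v v1; rewrite kH ?v1//; apply: fixs; last exact/unit_sphereP.
  by rewrite in_itv/= ler01 lexx.
by apply/seteqP; split=> [_ [v Av <-]|_ [v Av <-]]; exists v => //;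
  rewrite kH//; exact: Ab.
Qed.

Lemma tangle_class_rel_auto k A : in_ball A -> rel_auto k ->
  tangle_class A = tangle_class (k @` A).
Proof.
move=> Ab ka; have [g0 kg _] := ka.
have kAb := in_ball_image kg Ab.
apply/seteqP; split=> B [tB iB]; split=> //.
  have [k' ka' ->] := isotopic_rel_auto Ab iB.
  have [g ga gkA] := rel_auto_inv ka Ab.
  have -> : k' @` A = (k' \o g) @` (k @` A) by rewrite image_comp -[in LHS]gkA !image_comp.
  by apply: rel_auto_isotopic => //; exact: rel_auto_comp.
have [k' ka' ->] := isotopic_rel_auto kAb iB.
rewrite image_comp.
by apply: rel_auto_isotopic => //; exact: rel_auto_comp.
Qed.

End RelativeHomeomorphisms.

(** * The pillowcase norm *)
Section Gauge.
Variable R : realType.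
Implicit Types (v : R * R * R) (a g : R).

(** The norm whose unit sphere is the pillowcase
[z^2 = (1 - x^2) (1 - y^2), |x|, |y| <= 1].  On the ray through
[(x, y, z)] it becomes a quadratic equation for the square of the norm, and
the square root of the larger solution is half the sum of two Euclidean
norms. *)
Definition gauge v : R :=
  (Num.sqrt ((v.1.1 - v.1.2) ^+ 2 + v.2 ^+ 2)
   + Num.sqrt ((v.1.1 + v.1.2) ^+ 2 + v.2 ^+ 2)) / 2.

(** The norm whose unit ball is the cylinder around the y-axis, the analogue of
[gauge] for slices that are circles. *)
Definition cyl v : R :=
  Num.max `|v.1.2| (Num.sqrt (v.1.1 ^+ 2 + v.2 ^+ 2)).

Lemma gauge_ge0 v : 0 <= gauge v.
Proof. by rewrite /gauge divr_ge0// addr_ge0// sqrtr_ge0. Qed.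

Lemma gauge_ge v : `|v.1.1| <= gauge v /\ `|v.1.2| <= gauge v.
Proof.
case: v => [[x y] z]; rewrite /gauge/=.
set p := Num.sqrt _; set q := Num.sqrt _.
have hp : `|x - y| <= p.
  by rewrite -sqrtr_sqr ler_wsqrtr// lerDl sqr_ge0.
have hq : `|x + y| <= q.
  by rewrite -sqrtr_sqr ler_wsqrtr// lerDl sqr_ge0.
move: hp hq; rewrite !ler_norml => /andP[? ?] /andP[? ?].
by split; apply/andP; split; lra.
Qed.

Lemma gauge_eq v : v.2 ^+ 2 * gauge v ^+ 2 =
  (gauge v ^+ 2 - v.1.1 ^+ 2) * (gauge v ^+ 2 - v.1.2 ^+ 2).
Proof.
case: v => [[x y] z]; rewrite /gauge/=.
set p := Num.sqrt _; set q := Num.sqrt _.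
have hp : p ^+ 2 = (x - y) ^+ 2 + z ^+ 2.
  by rewrite sqr_sqrtr// addr_ge0// sqr_ge0.
have hq : q ^+ 2 = (x + y) ^+ 2 + z ^+ 2.
  by rewrite sqr_sqrtr// addr_ge0// sqr_ge0.
have hxy : x * y = (q ^+ 2 - p ^+ 2) / 4 by rewrite hp hq; field.
have hz : z ^+ 2 = (p ^+ 2 + q ^+ 2) / 2 - x ^+ 2 - y ^+ 2 by rewrite hp hq; field.
have -> : (((p + q) / 2) ^+ 2 - x ^+ 2) * (((p + q) / 2) ^+ 2 - y ^+ 2) =
   ((p + q) / 2) ^+ 4 - (x ^+ 2 + y ^+ 2) * ((p + q) / 2) ^+ 2 + (x * y) ^+ 2.
  by ring.
by rewrite hz hxy; field.
Qed.

(** The two radicands in [gauge] are the squares of [g - x y / g] and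
[g + x y / g]. *)
Lemma gauge_unique v g : 0 < g -> `|v.1.1| <= g -> `|v.1.2| <= g ->
  v.2 ^+ 2 * g ^+ 2 = (g ^+ 2 - v.1.1 ^+ 2) * (g ^+ 2 - v.1.2 ^+ 2) -> gauge v = g.
Proof.
case: v => [[x y] z]/= g0 xg yg e; rewrite /gauge/=.
have gn : g != 0 by rewrite gt_eqF.
have hz : z ^+ 2 = (g ^+ 2 - x ^+ 2) * (g ^+ 2 - y ^+ 2) / g ^+ 2.
  by rewrite -e mulfK// expf_neq0.
have -> : (x - y) ^+ 2 + z ^+ 2 = (g - x * y / g) ^+ 2 by rewrite hz; field.
have -> : (x + y) ^+ 2 + z ^+ 2 = (g + x * y / g) ^+ 2 by rewrite hz; field.
have : `|x * y / g| <= g.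
  by rewrite !normrM normfV (gtr0_norm g0) ler_pdivrMr// ler_pM.
rewrite ler_norml => /andP[? ?].
by rewrite !sqrtr_sqr !ger0_norm; [field|lra|lra].
Qed.

Lemma gauge_gt0 v : v <> 0 -> 0 < gauge v.
Proof.
move=> v0; rewrite lt_neqAle gauge_ge0 andbT eq_sym; apply/eqP => g0.
apply: v0; have [] := gauge_ge v; rewrite g0 !normr_le0 => /eqP x0 /eqP y0.
move: g0; rewrite /gauge; case: v x0 y0 => [[x y] z]/= -> ->.
rewrite subrr addr0 expr0n/= add0r sqrtr_sqr => h.
have /normr0_eq0 -> // : `|z| = 0 by lra.
Qed.

Lemma gaugeZ a v : 0 < a -> gauge (a *: v) = a * gauge v.
Proof.
move=> a0; rewrite /gauge.
have -> : (a *: v).1.1 = a * v.1.1 by [].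
have -> : (a *: v).1.2 = a * v.1.2 by [].
have -> : (a *: v).2 = a * v.2 by [].
have -> : (a * v.1.1 - a * v.1.2) ^+ 2 + (a * v.2) ^+ 2 =
  a ^+ 2 * ((v.1.1 - v.1.2) ^+ 2 + v.2 ^+ 2) by ring.
have -> : (a * v.1.1 + a * v.1.2) ^+ 2 + (a * v.2) ^+ 2 =
  a ^+ 2 * ((v.1.1 + v.1.2) ^+ 2 + v.2 ^+ 2) by ring.
by rewrite !(sqrtrM _ (sqr_ge0 a)) sqrtr_sqr gtr0_norm//; field.
Qed.

Lemma continuous_gauge : continuous gauge.
Proof.
move=> v; suff : {for v, continuous (fun v => (Num.sqrt ((v.1.1 - v.1.2) ^+ 2 + v.2 ^+ 2)
   + Num.sqrt ((v.1.1 + v.1.2) ^+ 2 + v.2 ^+ 2)) / 2)} by [].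
by ctac.
Qed.

Lemma cyl_ge v : `|v.1.1| <= cyl v /\ `|v.1.2| <= cyl v.
Proof.
split; rewrite /cyl le_max ?lexx//; apply/orP; right.
by rewrite -sqrtr_sqr ler_wsqrtr// lerDl sqr_ge0.
Qed.

Lemma cyl_gt0 v : v <> 0 -> 0 < cyl v.
Proof.
case: v => [[x y] z] v0; rewrite /cyl/= lt_max; apply/orP.
have [y0|y0] := eqVneq y 0; last by left; rewrite normr_gt0.
right; rewrite sqrtr_gt0 lt_neqAle addr_ge0 ?sqr_ge0// andbT eq_sym.
apply/eqP => /eqP; rewrite paddr_eq0 ?sqr_ge0// !sqrf_eq0 => /andP[/eqP x0 /eqP z0].
by apply: v0; rewrite x0 y0 z0.
Qed.

Lemma cylZ a v : 0 < a -> cyl (a *: v) = a * cyl v.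
Proof.
move=> a0; rewrite /cyl.
have -> : (a *: v).1.1 = a * v.1.1 by [].
have -> : (a *: v).1.2 = a * v.1.2 by [].
have -> : (a *: v).2 = a * v.2 by [].
have -> : (a * v.1.1) ^+ 2 + (a * v.2) ^+ 2 =
  a ^+ 2 * (v.1.1 ^+ 2 + v.2 ^+ 2) by ring.
by rewrite (sqrtrM _ (sqr_ge0 a)) sqrtr_sqr normrM gtr0_norm// maxr_pMr// ltW.
Qed.

Lemma continuous_cyl : continuous cyl.
Proof.
move=> v; suff : {for v, continuous (fun v => 
  Num.max `|v.1.2| (Num.sqrt (v.1.1 ^+ 2 + v.2 ^+ 2)))} by [].
by ctac.
Qed.

Definition gauge_lat v := v.1.2 / gauge v.
Definition cyl_lat v := v.1.2 / cyl v.

Lemma gauge_latZ a v : 0 < a -> gauge_lat (a *: v) = gauge_lat v.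
Proof.
move=> a0; rewrite /gauge_lat gaugeZ//; have -> : (a *: v).1.2 = a * v.1.2 by [].
by rewrite -mulf_div divff ?gt_eqF// mul1r.
Qed.

Lemma cyl_latZ a v : 0 < a -> cyl_lat (a *: v) = cyl_lat v.
Proof.
move=> a0; rewrite /cyl_lat cylZ//; have -> : (a *: v).1.2 = a * v.1.2 by [].
by rewrite -mulf_div divff ?gt_eqF// mul1r.
Qed.

Lemma gauge_lat_le1 v : v <> 0 -> `|gauge_lat v| <= 1.
Proof.
move=> /gauge_gt0 g0; rewrite /gauge_lat normrM normfV (gtr0_norm g0) ler_pdivrMr//.
by rewrite mul1r; case: (gauge_ge v).
Qed.

Lemma cyl_lat_le1 v : v <> 0 -> `|cyl_lat v| <= 1.
Proof.
move=> /cyl_gt0 g0; rewrite /cyl_lat normrM normfV (gtr0_norm g0) ler_pdivrMr//.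
by rewrite mul1r; case: (cyl_ge v).
Qed.

Lemma continuous_gauge_lat v : v <> 0 -> {for v, continuous gauge_lat}.
Proof.
move=> v0; suff : {for v, continuous (fun v => v.1.2 / gauge v)} by [].
apply: ctM; ctac; apply: ctV; first by rewrite gt_eqF// gauge_gt0.
exact: continuous_gauge.
Qed.

Lemma continuous_cyl_lat v : v <> 0 -> {for v, continuous cyl_lat}.
Proof.
move=> v0; suff : {for v, continuous (fun v => v.1.2 / cyl v)} by [].
apply: ctM; ctac; apply: ctV; first by rewrite gt_eqF// cyl_gt0.
exact: continuous_cyl.
Qed.

(** The slice of the pillowcase at height [e] is an ellipse with semi-axes [1]
along x and [axis_ratio e] along z. *)
Definition axis_ratio (e : R) := Num.sqrt (1 - e ^+ 2).

Lemma axis_ratio_ge0 e : 0 <= axis_ratio e. Proof. exact: sqrtr_ge0. Qed.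

Lemma sqr_axis_ratio e : `|e| <= 1 -> axis_ratio e ^+ 2 = 1 - e ^+ 2.
Proof. by move=> e1; rewrite sqr_sqrtr// subr_ge0 -real_normK ?num_real// expr_le1. Qed.

Lemma axis_ratio_le1 e : axis_ratio e <= 1.
Proof. by rewrite -[leRHS]sqrtr1 ler_wsqrtr// gerBl sqr_ge0. Qed.

Lemma axis_ratio_gauge v : v <> 0 ->
  v.1.1 ^+ 2 * axis_ratio (gauge_lat v) ^+ 2 + v.2 ^+ 2 = gauge v ^+ 2 * axis_ratio (gauge_lat v) ^+ 2.
Proof.
move=> v0; have g0 := gauge_gt0 v0; have gn : gauge v != 0 by rewrite gt_eqF.
rewrite sqr_axis_ratio ?gauge_lat_le1//.
have -> : v.2 ^+ 2 =
    (gauge v ^+ 2 - v.1.1 ^+ 2) * (gauge v ^+ 2 - v.1.2 ^+ 2) / gauge v ^+ 2.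
  by rewrite -gauge_eq mulfK// expf_neq0.
by rewrite /gauge_lat; field.
Qed.

End Gauge.

(** * Norm-preserving homeomorphisms from families of directions *)
Section NormalisedFamilies.
Variable R : realType.
Implicit Types (v : R * R * R) (a r : R).
Implicit Types (h g : R * R * R -> R * R * R) (F G : R -> R * R * R -> R * R * R).

Definition norm_auto h g := [/\ continuous h, continuous g,
  forall v, enorm (h v) = enorm v, cancel h g & cancel g h].

Lemma norm_auto_sym h g : norm_auto h g -> norm_auto g h.
Proof. by move=> [ch cg hn hg gh]; split=> // v; rewrite -{2}(gh v) hn. Qed.

Lemma norm_auto_comp h g h' g' : norm_auto h g -> norm_auto h' g' ->
  norm_auto (h' \o h) (g \o g').
Proof.
move=> [ch cg hn hg gh] [ch' cg' hn' hg' gh']; split.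
- by move=> v; apply: continuous_comp; [exact: ch|exact: ch'].
- by move=> v; apply: continuous_comp; [exact: cg'|exact: cg].
- by move=> v; rewrite /= hn' hn.
- by move=> v /=; rewrite hg' hg.
- by move=> v /=; rewrite gh gh'.
Qed.

Lemma norm_auto_id : norm_auto id id.
Proof. by split=> // v; exact: cvg_id. Qed.

Lemma norm_auto_ball h g : norm_auto h g -> ball_auto h g.
Proof.
move=> /[dup] /norm_auto_sym [_ _ gn _ _] [ch cg hn hg gh].
by split=> // v v1; rewrite (hn, gn) (hg, gh); split.
Qed.

(** Each [F r] describes a homogeneous map of rays, used on the sphere of radius
[r]; rescaling to the original norm gives a map of the ball that preserves
every concentric sphere. *)
Definition normalise F v := (enorm v / enorm (F (enorm v) v)) *: F (enorm v) v.

Definition homogeneous F := forall r a v, 0 < a -> F r (a *: v) = a *: F r v.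

Definition direction_family F := homogeneous F /\
  forall v, v <> 0 -> {for v, continuous (fun v => F (enorm v) v)}.

Lemma homogeneous0 F r : homogeneous F -> F r 0 = 0.
Proof.
move=> /(_ r 2 0 (ltr0Sn _ _)); rewrite scaler0 => e.
have : (1 : R) *: F r 0 = 0.
  have -> : (1 : R) = 2 - 1 by ring.
  by rewrite scalerBl scale1r -e subrr.
by rewrite scale1r.
Qed.

Lemma homogeneous_neq0 F G r v : homogeneous G ->
  (forall v, v <> 0 -> G r (F r v) = v) -> v <> 0 -> F r v <> 0.
Proof. by move=> hG GF v0 F0; apply: (v0); rewrite -(GF _ v0) F0 homogeneous0. Qed.

Lemma enorm_normalise F v : (v <> 0 -> F (enorm v) v <> 0) ->
  enorm (normalise F v) = enorm v.
Proof.
have [-> _|/eqP v0 /(_ v0) F0] := eqVneq v 0.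
  by rewrite /normalise enorm0 mul0r scale0r enorm0.
rewrite /normalise enormZ ger0_norm ?divr_ge0 ?enorm_ge0// divfK//.
by rewrite gt_eqF// enorm_gt0.
Qed.

Lemma normaliseK F G : homogeneous G ->
  (forall r v, v <> 0 -> G r (F r v) = v) -> cancel (normalise F) (normalise G).
Proof.
move=> hG GF v; have [->|/eqP v0] := eqVneq v 0.
  by rewrite /normalise !(enorm0, mul0r, scale0r).
have F0 : F (enorm v) v <> 0 by exact: (homogeneous_neq0 hG (GF _) v0).
rewrite {1}/normalise enorm_normalise//.
have p : 0 < enorm v / enorm (F (enorm v) v) by rewrite divr_gt0// enorm_gt0.
rewrite /normalise hG// GF// enormZ gtr0_norm// scalerA.
set c := enorm v / enorm _ in p *.
rewrite [X in X *: _](_ : _ = 1) ?scale1r//.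
have vp := enorm_gt0 v0.
by field; rewrite !gt_eqF.
Qed.

Lemma continuous_normalise F : direction_family F -> (forall v, v <> 0 -> F (enorm v) v <> 0) ->
  continuous (normalise F).
Proof.
move=> [hF cF] F0 v; have [->|/eqP v0] := eqVneq v 0.
  apply: norm_preserving_ct0 => w; exact/enorm_normalise/F0.
suff : {for v, continuous (fun v =>
    (enorm v / enorm (F (enorm v) v)) *: F (enorm v) v)} by [].
apply: ctZv; last exact: cF.
apply: ctM; first exact: continuous_enorm.
apply: ctV; first by rewrite gt_eqF// enorm_gt0//; exact: F0.
by apply: ctenorm; exact: cF.
Qed.

(** Homogeneity makes the rescaling commute with the maps, so an algebraic inverse
of the family is enough for a topological inverse of the normalised map. *)
Lemma normalise_auto F G : direction_family F -> direction_family G ->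
  (forall r v, v <> 0 -> G r (F r v) = v) ->
  (forall r v, v <> 0 -> F r (G r v) = v) ->
  norm_auto (normalise F) (normalise G).
Proof.
move=> fF fG GF FG.
have F0 v : v <> 0 -> F (enorm v) v <> 0.
  exact: (homogeneous_neq0 fG.1 (GF _)).
have G0 v : v <> 0 -> G (enorm v) v <> 0.
  exact: (homogeneous_neq0 fF.1 (FG _)).
split; [exact: continuous_normalise|exact: continuous_normalise| | | ].
- by move=> v; apply: enorm_normalise; exact: F0.
- exact: normaliseK fG.1 GF.
- exact: normaliseK fF.1 FG.
Qed.

Lemma normalise_eq F v : enorm (F (enorm v) v) = enorm v ->
  normalise F v = F (enorm v) v.
Proof.
move=> e; rewrite /normalise e; have [v0|v0] := eqVneq (enorm v) 0.
  by rewrite v0 in e *; rewrite (enorm_eq0 e) scaler0.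
by rewrite divff// scale1r.
Qed.

Lemma normalise_comp F G v : homogeneous F ->
  (v <> 0 -> G (enorm v) v <> 0) ->
  normalise F (normalise G v) = normalise (fun r => F r \o G r) v.
Proof.
move=> hF; have [->|/eqP v0 /(_ v0) G0] := eqVneq v 0.
  by rewrite /normalise !(enorm0, mul0r, scale0r).
rewrite {1}/normalise enorm_normalise//.
have p : 0 < enorm v / enorm (G (enorm v) v) by rewrite divr_gt0// enorm_gt0.
rewrite [in F _ _]/normalise hF// enormZ gtr0_norm// /normalise/= scalerA.
have [F0|/eqP F0] := eqVneq (F (enorm v) (G (enorm v) v)) 0.
  by rewrite F0 !scaler0.
congr (_ *: _); have vp := enorm_gt0 v0; have Gp := enorm_gt0 G0.
have Fp := enorm_gt0 F0.
by field; rewrite !gt_eqF.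
Qed.

End NormalisedFamilies.

(** * Rotations about the y-axis and rounding of ellipses *)
Section Twisting.
Variable R : realType.
Implicit Types (v : R * R * R) (a r s e : R) (c : R -> R).

Lemma scale3E a v : a *: v = (a * v.1.1, a * v.1.2, a * v.2).
Proof. by []. Qed.

Definition clamp01 (x : R) := Num.min 1 (Num.max 0 x).

Lemma clamp01_itv x : 0 <= clamp01 x <= 1.
Proof. by rewrite /clamp01 ge_min lexx le_min ler01 le_max lexx. Qed.

Lemma clamp01_le0 x : x <= 0 -> clamp01 x = 0.
Proof. by move=> x0; rewrite /clamp01 max_l// min_r// ler01. Qed.

Lemma clamp01_ge1 x : 1 <= x -> clamp01 x = 1.
Proof. by move=> x1; rewrite /clamp01 max_r ?min_l// (le_trans ler01). Qed.

Lemma clamp01_id x : 0 <= x <= 1 -> clamp01 x = x.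
Proof. by move=> /andP[x0 x1]; rewrite /clamp01 max_r// min_r. Qed.

Lemma ctclamp01 (T : topologicalType) (f : T -> R) x :
  {for x, continuous f} -> {for x, continuous (fun u => clamp01 (f u))}.
Proof. by move=> cf; rewrite /clamp01; ctac. Qed.

(** Time in the shell, from 0 on the inner half ball to 1 on the sphere.  On the
point with parameter [s] of a spoke it equals [s]. *)
Definition stage r := clamp01 (2 * r - 1).

(** The angle of the circular twist at latitude [e]: constant on the two caps
[|e| >= 3 / 5], which contain the marked points.  The bound [3 / 5] makes the
axis ratio [4 / 5] of the bounding ellipses rational. *)
Definition twist_angle (e : R) := pi * clamp01 ((1 - 5 / 3 * e) / 2).

Lemma twist_angle_lo e : e <= - (3 / 5) -> twist_angle e = pi.
Proof. by move=> h; rewrite /twist_angle clamp01_ge1 ?mulr1//; lra. Qed.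

Lemma twist_angle_hi e : 3 / 5 <= e -> twist_angle e = 0.
Proof. by move=> h; rewrite /twist_angle clamp01_le0 ?mulr0//; lra. Qed.

Lemma sin_twist_angle_ge0 e : 0 <= sin (twist_angle e).
Proof.
have /andP[c0 c1] := clamp01_itv ((1 - 5 / 3 * e) / 2).
apply: sin_ge0_pi; rewrite /twist_angle mulr_ge0 ?pi_ge0//=.
by rewrite ger_pMr// pi_gt0.
Qed.

Lemma ctstage (T : topologicalType) (f : T -> R) x :
  {for x, continuous f} -> {for x, continuous (fun u => stage (f u))}.
Proof. by move=> cf; rewrite /stage; apply: ctclamp01; ctac. Qed.

Lemma cttwist_angle (T : topologicalType) (f : T -> R) x :
  {for x, continuous f} -> {for x, continuous (fun u => twist_angle (f u))}.
Proof.
by move=> cf; rewrite /twist_angle; apply: ctM; [ctac|apply: ctclamp01; ctac].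
Qed.

Lemma ctaxis_ratio (T : topologicalType) (f : T -> R) x :
  {for x, continuous f} -> {for x, continuous (fun u => axis_ratio (f u))}.
Proof. by move=> cf; rewrite /axis_ratio; ctac. Qed.

Definition roty (phi : R) v : R * R * R :=
  (v.1.1 * cos phi + v.2 * sin phi, v.1.2, v.2 * cos phi - v.1.1 * sin phi).

Lemma rotyZ phi a v : roty phi (a *: v) = a *: roty phi v.
Proof.
by rewrite !scale3E /roty/=; congr (_, _, _); ring.
Qed.

Lemma roty_sqr phi v :
  (roty phi v).1.1 ^+ 2 + (roty phi v).2 ^+ 2 = v.1.1 ^+ 2 + v.2 ^+ 2.
Proof.
have := cos2Dsin2 phi; set C := cos phi; set S := sin phi => h.
rewrite /roty/= -/C -/S -[RHS]mulr1 -h; ring.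
Qed.

Lemma rotyK phi : cancel (roty phi) (roty (- phi)).
Proof.
move=> [[x y] z]; rewrite /roty/= cosN sinN.
have := cos2Dsin2 phi; set C := cos phi; set S := sin phi => h.
congr (_, _, _).
  by rewrite -[RHS]mulr1 -h; ring.
by rewrite -[RHS]mulr1 -h; ring.
Qed.

Lemma roty_neq0 phi v : v <> 0 -> roty phi v <> 0.
Proof.
move=> v0 r0; apply: v0; rewrite -(rotyK phi v) r0.
by rewrite -(scale0r (0 : R * R * R)) rotyZ !scale0r.
Qed.

Lemma enorm_roty phi v : enorm (roty phi v) = enorm v.
Proof.
rewrite /enorm /sqnorm -addrAC roty_sqr; congr Num.sqrt.
by rewrite /roty/=; ring.
Qed.

Lemma cyl_roty phi v : cyl (roty phi v) = cyl v.
Proof. by rewrite /cyl roty_sqr. Qed.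

Lemma cyl_lat_roty phi v : cyl_lat (roty phi v) = cyl_lat v.
Proof. by rewrite /cyl_lat cyl_roty. Qed.

Definition roty_family (c : R -> R) r v := roty (c r * twist_angle (cyl_lat v)) v.

Lemma roty_familyP c : continuous c -> direction_family (roty_family c).
Proof.
move=> cc; split; first by move=> r a v a0; rewrite /roty_family cyl_latZ// rotyZ.
move=> v v0; rewrite /roty_family /roty.
have cl := continuous_cyl_lat v0.
have ca : {for v, continuous (fun v => c (enorm v) * twist_angle (cyl_lat v))}.
  apply: ctM; last exact: cttwist_angle.
  by apply: continuous_comp; [exact: continuous_enorm|exact: cc].
by ctac.
Qed.

Lemma roty_familyK c r v : roty_family (fun r => - c r) r (roty_family c r v) = v.
Proof. by rewrite /roty_family cyl_lat_roty mulNr rotyK. Qed.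

Lemma roty_family_auto c : continuous c ->
  norm_auto (normalise (roty_family c)) (normalise (roty_family (fun r => - c r))).
Proof.
move=> cc; apply: normalise_auto.
- exact: roty_familyP.
- by apply: roty_familyP => r; apply: cvgN; exact: cc.
- by move=> r v _; exact: roty_familyK.
- move=> r v _; rewrite -{2}(roty_familyK (fun r => - c r) r v).
  by rewrite /roty_family opprK.
Qed.

Lemma normalise_roty c v : normalise (roty_family c) v = roty_family c (enorm v) v.
Proof. by rewrite normalise_eq// enorm_roty. Qed.

(** [round_family] stretches along z; with a stretching factor [1 / axis_ratio]
the elliptic slices become circles.  The factor is bounded by
[1 / roundness r], since the ellipses degenerate at the poles; at [r = 1] the
bound is only active on the caps, where the twist angle is constant.  On the
inner half ball the map is the identity. *)
Definition roundness r := 1 - stage r / 5.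

Definition round_family r v : R * R * R :=
  (v.1.1, v.1.2, v.2 / Num.max (roundness r) (axis_ratio (gauge_lat v))).
Definition flat_family r v : R * R * R :=
  (v.1.1, v.1.2, v.2 * Num.max (roundness r) (axis_ratio (cyl_lat v))).

Lemma roundness_itv r : 4 / 5 <= roundness r <= 1.
Proof. by rewrite /roundness /stage; have := clamp01_itv (2 * r - 1); lra. Qed.

Lemma ctroundness (T : topologicalType) (f : T -> R) x :
  {for x, continuous f} -> {for x, continuous (fun u => roundness (f u))}.
Proof.
move=> cf; rewrite /roundness; have := ctstage cf => cs.
by apply: ctD; [ctac|apply: ctN; apply: ctM; ctac].
Qed.

Lemma round_max_gt0 r e : 0 < Num.max (roundness r) e.
Proof. by rewrite lt_max; have := roundness_itv r; case: ltP => //; lra. Qed.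

Lemma round_familyP : direction_family round_family.
Proof.
split.
  by move=> r a v a0; rewrite /round_family gauge_latZ// !scale3E/=; congr (_, _, _); ring.
move=> v v0; rewrite /round_family.
have cl := ctaxis_ratio (continuous_gauge_lat v0).
have cs := ctroundness (@continuous_enorm R v).
ctac; apply: ctV; last by ctac.
by rewrite gt_eqF// round_max_gt0.
Qed.

Lemma flat_familyP : direction_family flat_family.
Proof.
split.
  by move=> r a v a0; rewrite /flat_family cyl_latZ// !scale3E/=; congr (_, _, _); ring.
move=> v v0; rewrite /flat_family.
have cl := ctaxis_ratio (continuous_cyl_lat v0).
have cs := ctroundness (@continuous_enorm R v).
by ctac.
Qed.

End Twisting.

Section Rounding.
Variable R : realType.
Implicit Types (v : R * R * R) (a r s e : R) (c : R -> R).

Lemma axis_ratio_anti (a b : R) : `|a| <= `|b| -> axis_ratio b <= axis_ratio a.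
Proof.
move=> ab; rewrite /axis_ratio ler_wsqrtr// lerD2l lerN2.
by rewrite -(real_normK (num_real a)) -(real_normK (num_real b)) lerXn2r ?nnegrE.
Qed.

Lemma axis_ratio_ge e : `|e| <= 3 / 5 -> 4 / 5 <= axis_ratio e.
Proof.
move=> h; have -> : 4 / 5 = axis_ratio (3 / 5) :> R.
  have -> : 4 / 5 = `|4 / 5| :> R by rewrite ger0_norm//; lra.
  by rewrite -sqrtr_sqr /axis_ratio; congr Num.sqrt; field.
by apply: axis_ratio_anti; rewrite (le_trans h)// ler_norm.
Qed.

Lemma axis_ratio_le e : 3 / 5 <= `|e| -> axis_ratio e <= 4 / 5.
Proof.
move=> h; have -> : 4 / 5 = axis_ratio (3 / 5) :> R.
  have -> : 4 / 5 = `|4 / 5| :> R by rewrite ger0_norm//; lra.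
  by rewrite -sqrtr_sqr /axis_ratio; congr Num.sqrt; field.
by apply: axis_ratio_anti; rewrite ger0_norm//; lra.
Qed.

Lemma sqr_le_cyl v : v.1.1 ^+ 2 + v.2 ^+ 2 <= cyl v ^+ 2.
Proof.
have h : Num.sqrt (v.1.1 ^+ 2 + v.2 ^+ 2) <= cyl v by rewrite /cyl le_max lexx orbT.
rewrite -[leLHS]sqr_sqrtr ?addr_ge0 ?sqr_ge0// lerXn2r ?nnegrE ?sqrtr_ge0//.
exact: le_trans h.
Qed.

Lemma sqr_cyl v : `|v.1.2| < cyl v -> cyl v ^+ 2 = v.1.1 ^+ 2 + v.2 ^+ 2.
Proof.
rewrite /cyl; case: (leP `|v.1.2| (Num.sqrt _)) => [_ _|_]; last by rewrite ltxx.
by rewrite sqr_sqrtr// addr_ge0 ?sqr_ge0.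
Qed.

(** Where the factor is the full [1 / axis_ratio], the slice becomes a circle of
radius [gauge v]. *)
Lemma cyl_lat_round r v : v <> 0 -> roundness r <= axis_ratio (gauge_lat v) ->
  cyl_lat (round_family r v) = gauge_lat v.
Proof.
move=> v0 de; have e0 : 0 < axis_ratio (gauge_lat v).
  by apply: lt_le_trans de; have := roundness_itv r; lra.
have g0 := gauge_gt0 v0; rewrite /cyl_lat /gauge_lat; congr (_ / _).
rewrite /cyl /round_family/= (max_r de).
have -> : v.1.1 ^+ 2 + (v.2 / axis_ratio (gauge_lat v)) ^+ 2 = gauge v ^+ 2.
  have := axis_ratio_gauge v0; have : axis_ratio (gauge_lat v) != 0 by rewrite gt_eqF.
  set e := axis_ratio _ => en h.
  have -> : v.1.1 ^+ 2 + (v.2 / e) ^+ 2 = (v.1.1 ^+ 2 * e ^+ 2 + v.2 ^+ 2) / e ^+ 2.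
    by field.
  by rewrite h; field.
by rewrite sqrtr_sqr (gtr0_norm g0) max_r//; case: (gauge_ge v).
Qed.

Lemma cyl_round_le r v : v <> 0 -> axis_ratio (gauge_lat v) <= roundness r ->
  cyl (round_family r v) <= gauge v.
Proof.
move=> v0 ed; have d0 : 0 < roundness r by have := roundness_itv r; lra.
have g0 := gauge_gt0 v0; have [gx gy] := gauge_ge v.
rewrite /cyl /round_family/= (max_l ed) ge_max gy/=.
rewrite -[leRHS](gtr0_norm g0) -sqrtr_sqr ler_wsqrtr//.
have := axis_ratio_gauge v0; have := axis_ratio_ge0 (gauge_lat v); move: ed; set e := axis_ratio _ => ed e0 h.
rewrite -lerBrDl expr_div_n.
have -> : v.2 ^+ 2 = (gauge v ^+ 2 - v.1.1 ^+ 2) * e ^+ 2 by rewrite mulrBl -h; ring.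
rewrite ler_pdivrMr ?exprn_gt0// ler_wpM2l//.
  by rewrite subr_ge0 -(real_normK (num_real v.1.1)) lerXn2r ?nnegrE ?(ltW g0).
by rewrite lerXn2r ?nnegrE ?(ltW d0).
Qed.

Lemma round_neq0 r v : v <> 0 -> round_family r v <> 0.
Proof.
have := round_max_gt0 r (axis_ratio (gauge_lat v)); rewrite /round_family.
case: v => [[x y] z]/= M0 v0 [x0 y0 /eqP]; rewrite mulf_eq0 invr_eq0 (gt_eqF M0) orbF.
by move=> /eqP z0; apply: v0; rewrite x0 y0 z0.
Qed.

Lemma flat_neq0 r v : v <> 0 -> flat_family r v <> 0.
Proof.
have := round_max_gt0 r (axis_ratio (cyl_lat v)); rewrite /flat_family.
case: v => [[x y] z]/= M0 v0 [x0 y0 /eqP]; rewrite mulf_eq0 (gt_eqF M0) orbF.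
by move=> /eqP z0; apply: v0; rewrite x0 y0 z0.
Qed.

Lemma ler_lat (y g m : R) : 0 < m -> m <= g -> `|y / g| <= `|y / m|.
Proof.
move=> m0 mg; have g0 := lt_le_trans m0 mg.
by rewrite !normrM ler_wpM2l// !normfV !gtr0_norm// lef_pV2.
Qed.

Lemma gauge_lat_round_le r v : v <> 0 -> axis_ratio (gauge_lat v) <= roundness r ->
  `|gauge_lat v| <= `|cyl_lat (round_family r v)|.
Proof.
move=> v0 ed; apply: ler_lat; last exact: cyl_round_le.
exact/cyl_gt0/round_neq0.
Qed.

Lemma max_round r v : v <> 0 ->
  Num.max (roundness r) (axis_ratio (cyl_lat (round_family r v))) =
  Num.max (roundness r) (axis_ratio (gauge_lat v)).
Proof.
move=> v0; have [ed|/ltW de] := leP (axis_ratio (gauge_lat v)) (roundness r).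
  by rewrite max_l// (le_trans _ ed)// axis_ratio_anti// gauge_lat_round_le.
by rewrite cyl_lat_round// max_r.
Qed.

Lemma flat_roundK r v : v <> 0 -> flat_family r (round_family r v) = v.
Proof.
move=> v0; rewrite /flat_family max_round//; have := round_max_gt0 r (axis_ratio (gauge_lat v)).
by case: v v0 => [[x y] z]/= v0 M0; rewrite divfK// gt_eqF.
Qed.

(** The ratio by which [flat_family] shrinks, read off before shrinking, is the
ratio by which [round_family] stretches afterwards; with [max_round] this
makes the two families inverse to each other. *)
Lemma max_flat r v : v <> 0 ->
  Num.max (roundness r) (axis_ratio (gauge_lat (flat_family r v))) =
  Num.max (roundness r) (axis_ratio (cyl_lat v)).
Proof.
move=> v0; have m0 := cyl_gt0 v0; have mn : cyl v != 0 by rewrite gt_eqF.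
have d0 : 0 < roundness r by have := roundness_itv r; lra.
have f0 := flat_neq0 (r := r) v0.
have [mx my] := cyl_ge v.
have [ed|/ltW de] := leP (axis_ratio (cyl_lat v)) (roundness r).
  (* If the image had a larger axis ratio than [roundness r], its gauge would be
     at most [cyl v], hence its latitude at least that of [v], and so its axis
     ratio at most that of [v]. *)
  apply/max_l; rewrite leNgt; apply/negP => dlt.
  have g0 := gauge_gt0 f0; have h := axis_ratio_gauge f0.
  suff : axis_ratio (gauge_lat (flat_family r v)) <= axis_ratio (cyl_lat v).
    by move=> /le_trans /(_ ed); rewrite leNgt dlt.
  apply: axis_ratio_anti; apply: ler_lat => //.
  rewrite -(@ler_pXn2r _ 2)// ?nnegrE ?(ltW m0) ?(ltW g0)//; apply: le_trans (sqr_le_cyl v).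
  move: dlt h; set e := axis_ratio _; set g := gauge _ => dlt.
  rewrite /flat_family/= (max_l ed) => h.
  have e0 : 0 < e by exact: lt_trans dlt.
  have -> : g ^+ 2 = (v.1.1 ^+ 2 * e ^+ 2 + (v.2 * roundness r) ^+ 2) / e ^+ 2.
    by rewrite h; field; rewrite gt_eqF.
  rewrite mulrDl mulfK ?expf_neq0 ?gt_eqF// lerD2l ler_pdivrMr ?exprn_gt0//.
  by rewrite exprMn ler_wpM2l ?sqr_ge0// lerXn2r ?nnegrE ?(ltW d0) ?(ltW e0) ?(ltW dlt).
suff -> : gauge_lat (flat_family r v) = cyl_lat v by rewrite max_r.
rewrite /gauge_lat /cyl_lat; congr (_ / _); apply: gauge_unique => //.
rewrite /flat_family/= (max_r de) exprMn sqr_axis_ratio ?cyl_lat_le1//.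
have e0 : 0 < axis_ratio (cyl_lat v) by exact: lt_le_trans de.
have ym : `|v.1.2| < cyl v.
  rewrite lt_neqAle my andbT; apply/eqP => ym.
  move: e0; rewrite /axis_ratio /cyl_lat -ym expr_div_n real_normK ?num_real//.
  have y0 : v.1.2 ^+ 2 != 0 by rewrite sqrf_eq0 -normr_eq0 ym.
  by rewrite divff// subrr sqrtr0 ltxx.
by rewrite /cyl_lat (sqr_cyl ym) -(sqr_cyl ym) [in v.2 ^+ 2](_ : v.2 ^+ 2 = cyl v ^+ 2 - v.1.1 ^+ 2);
  [field|rewrite (sqr_cyl ym); ring].
Qed.

Lemma round_flatK r v : v <> 0 -> round_family r (flat_family r v) = v.
Proof.
move=> v0; rewrite /round_family max_flat//; have := round_max_gt0 r (axis_ratio (cyl_lat v)).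
by case: v v0 => [[x y] z]/= v0 M0; rewrite mulfK// gt_eqF.
Qed.

Lemma round_auto :
  norm_auto (normalise (@round_family R)) (normalise (@flat_family R)).
Proof.
apply: normalise_auto; [exact: round_familyP|exact: flat_familyP| |] => r v v0.
  exact: flat_roundK.
exact: round_flatK.
Qed.

End Rounding.

(** * Sliding along the ellipses *)
Section Tilting.
Variable R : realType.
Implicit Types (v : R * R * R) (a r s e : R) (c : R -> R).

(** Sliding along the ellipse at height [e] by an angle with cosine [C] and sine
[K * axis_ratio e] is the map [shear C K].  The half twist of the pillowcase
has [C = e] and [K = 1], the circular twist has [C] and [K] given by
[twist_angle] and [twist_slope].  [tiltC s] and [tiltK s] interpolate: the two
points (cosine, sine) of the unit circle lie in the upper half and are never
antipodal, so the segment between them avoids the origin and can be projected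
back to the circle. *)
Definition twist_slope e := sin (twist_angle e) / Num.max (axis_ratio e) (4 / 5).
Definition tiltA s e := (1 - s) * cos (twist_angle e) + s * e.
Definition tiltB s e := (1 - s) * twist_slope e + s.
Definition tiltN s e := Num.sqrt (tiltA s e ^+ 2 + tiltB s e ^+ 2 * axis_ratio e ^+ 2).
Definition tiltC s e := tiltA s e / tiltN s e.
Definition tiltK s e := tiltB s e / tiltN s e.

Lemma max_axis_ratio_gt0 e : 0 < Num.max (axis_ratio e) (4 / 5).
Proof. by rewrite lt_max; apply/orP; right; lra. Qed.

Lemma twist_angle_cases e :
  [\/ `|e| <= 3 / 5, e <= - (3 / 5) | 3 / 5 <= e].
Proof.
have [h|h] := leP `|e| (3 / 5); first by constructor 1.
move: h; rewrite lter_normr => /orP[h|h]; first by constructor 3; rewrite ltW.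
by constructor 2; lra.
Qed.

Lemma twist_slopeE e : twist_slope e * axis_ratio e = sin (twist_angle e).
Proof.
rewrite /twist_slope; case: (twist_angle_cases e) => h.
- rewrite max_l ?axis_ratio_ge// divfK// gt_eqF//.
  by apply: lt_le_trans (axis_ratio_ge h); lra.
- by rewrite twist_angle_lo// sinpi !mul0r.
- by rewrite twist_angle_hi// sin0 !mul0r.
Qed.

Lemma twist_slope_ge0 e : 0 <= twist_slope e.
Proof. by rewrite divr_ge0 ?sin_twist_angle_ge0// ltW// max_axis_ratio_gt0. Qed.

Lemma tiltN2_gt0 s e : 0 <= s <= 1 -> `|e| <= 1 ->
  0 < tiltA s e ^+ 2 + tiltB s e ^+ 2 * axis_ratio e ^+ 2.
Proof.
move=> /andP[s0 s1] e1.
have p1 := sqr_ge0 (tiltA s e); have p2 := sqr_ge0 (tiltB s e * axis_ratio e).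
rewrite exprMn in p2.
have nz (x : R) : x != 0 -> 0 < x ^+ 2 by move=> x0; rewrite lt_neqAle sqr_ge0 eq_sym sqrf_eq0 x0.
case: (twist_angle_cases e) => h.
- have [->|sn] := eqVneq s 0.
    rewrite /tiltA /tiltB subr0 !mul1r !mul0r !addr0 -exprMn twist_slopeE.
    by rewrite cos2Dsin2.
  apply: ltr_wpDl => //; rewrite -exprMn; apply: nz.
  have k0 := twist_slope_ge0 e; have e0 := axis_ratio_ge h.
  have sp : 0 < s by rewrite lt_neqAle eq_sym sn.
  rewrite gt_eqF// mulr_gt0//; last lra.
  by rewrite /tiltB ltr_wpDl// mulr_ge0// subr_ge0.
- apply: ltr_pwDl => //; apply: nz.
  by rewrite /tiltA twist_angle_lo// cospi lt_eqF//; nra.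
- apply: ltr_pwDl => //; apply: nz.
  by rewrite /tiltA twist_angle_hi// cos0 gt_eqF//; nra.
Qed.

Lemma tilt_unit s e : 0 <= s <= 1 -> `|e| <= 1 ->
  tiltC s e ^+ 2 + tiltK s e ^+ 2 * axis_ratio e ^+ 2 = 1.
Proof.
move=> s01 e1; have n0 := tiltN2_gt0 s01 e1.
have n : tiltN s e ^+ 2 = tiltA s e ^+ 2 + tiltB s e ^+ 2 * axis_ratio e ^+ 2.
  by rewrite sqr_sqrtr// ltW.
rewrite /tiltC /tiltK !expr_div_n [X in _ + X]mulrAC -mulrDl -n divff//.
by rewrite n gt_eqF.
Qed.

Lemma tilt0 e : tiltC 0 e = cos (twist_angle e) /\ tiltK 0 e = twist_slope e.
Proof.
have n1 : tiltN 0 e = 1.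
  rewrite /tiltN /tiltA /tiltB subr0 !mul1r !mul0r !addr0 -exprMn twist_slopeE.
  by rewrite cos2Dsin2 sqrtr1.
by rewrite /tiltC /tiltK n1 !divr1 /tiltA /tiltB subr0 !mul1r !mul0r !addr0.
Qed.

Lemma tilt1 e : `|e| <= 1 -> tiltC 1 e = e /\ tiltK 1 e = 1.
Proof.
move=> e1.
have n1 : tiltN 1 e = 1.
  rewrite /tiltN /tiltA /tiltB subrr !mul1r !mul0r !add0r expr1n mul1r.
  by rewrite sqr_axis_ratio// addrC subrK sqrtr1.
by rewrite /tiltC /tiltK n1 !divr1 /tiltA /tiltB subrr !mul1r !mul0r !add0r.
Qed.

Definition shear (C K e2 : R) v : R * R * R :=
  (v.1.1 * C + v.2 * K, v.1.2, v.2 * C - v.1.1 * K * e2).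

Lemma shearK C K e2 v : C ^+ 2 + K ^+ 2 * e2 = 1 ->
  shear C (- K) e2 (shear C K e2 v) = v.
Proof.
case: v => [[x y] z] h; rewrite /shear/=; congr (_, _, _).
  by rewrite -[RHS]mulr1 -h; ring.
by rewrite -[RHS]mulr1 -h; ring.
Qed.

(** The slide preserves the height and the ellipse, hence the pillowcase; the
case of axis ratio 0 concerns the two degenerate slices, which are segments
and are either fixed or reflected. *)
Lemma gauge_shear C K v : v <> 0 -> C ^+ 2 + K ^+ 2 * axis_ratio (gauge_lat v) ^+ 2 = 1 ->
  gauge (shear C K (axis_ratio (gauge_lat v) ^+ 2) v) = gauge v.
Proof.
move=> v0 h; have g0 := gauge_gt0 v0; have [gx gy] := gauge_ge v.
have e2 := sqr_axis_ratio (gauge_lat_le1 v0); have q := axis_ratio_gauge v0.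
move: h e2 q; set e := axis_ratio _ => h e2 q.
have q' : (v.1.1 * C + v.2 * K) ^+ 2 * e ^+ 2 +
    (v.2 * C - v.1.1 * K * e ^+ 2) ^+ 2 = gauge v ^+ 2 * e ^+ 2.
  by rewrite -q -[RHS]mulr1 -h; ring.
apply: gauge_unique => //=.
- have [e0|en] := eqVneq e 0.
    have z0 : v.2 = 0.
      by move: q; rewrite e0 expr0n/= !mulr0 add0r => /eqP; rewrite sqrf_eq0 => /eqP.
    move: h; rewrite e0 expr0n/= mulr0 addr0 => /eqP; rewrite sqrf_eq1.
    by rewrite z0 mul0r addr0 => /orP[/eqP->|/eqP->]; rewrite ?mulrN mulr1 ?normrN.
  rewrite -(@ler_pXn2r _ 2)// ?nnegrE ?(ltW g0)// real_normK ?num_real//.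
  have ep : 0 < e ^+ 2 by rewrite lt_neqAle sqr_ge0 eq_sym sqrf_eq0 en.
  by rewrite -(ler_pM2r ep) -q' lerDl sqr_ge0.
- have -> : (v.2 * C - v.1.1 * K * e ^+ 2) ^+ 2 =
     (gauge v ^+ 2 - (v.1.1 * C + v.2 * K) ^+ 2) * e ^+ 2.
    by rewrite mulrBl -q'; ring.
  rewrite -mulrA; congr (_ * _); rewrite e2 /gauge_lat; field.
  by rewrite gt_eqF.
Qed.

Definition tilt_family c (b : R) r v :=
  shear (tiltC (c r) (gauge_lat v)) (b * tiltK (c r) (gauge_lat v)) (axis_ratio (gauge_lat v) ^+ 2) v.

Lemma gauge_lat_shear C K v : v <> 0 -> C ^+ 2 + K ^+ 2 * axis_ratio (gauge_lat v) ^+ 2 = 1 ->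
  gauge_lat (shear C K (axis_ratio (gauge_lat v) ^+ 2) v) = gauge_lat v.
Proof. by move=> v0 h; rewrite {1}/gauge_lat gauge_shear. Qed.

Lemma shearZ C K e2 a v : shear C K e2 (a *: v) = a *: shear C K e2 v.
Proof. by rewrite !scale3E /shear/=; congr (_, _, _); ring. Qed.

Section Param.
Variable c : R -> R.
Hypothesis cc : continuous c.
Hypothesis c01 : forall r, 0 <= c r <= 1.

Lemma tilt_familyP b : direction_family (tilt_family c b).
Proof.
split; first by move=> r a v a0; rewrite /tilt_family gauge_latZ// shearZ.
move=> v v0; rewrite /tilt_family /shear.
have cl := continuous_gauge_lat v0; have ce := ctaxis_ratio cl; have ch := cttwist_angle cl.
have cs : {for v, continuous (fun v => c (enorm v))}.
  by apply: continuous_comp; [exact: continuous_enorm|exact: cc].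
have cA : {for v, continuous (fun v => tiltA (c (enorm v)) (gauge_lat v))}.
  by rewrite /tiltA; ctac.
have ck : {for v, continuous (fun v => twist_slope (gauge_lat v))}.
  rewrite /twist_slope; apply: ctM; first by ctac.
  by apply: ctV; [rewrite gt_eqF// max_axis_ratio_gt0|ctac].
have cB : {for v, continuous (fun v => tiltB (c (enorm v)) (gauge_lat v))}.
  by rewrite /tiltB; ctac.
have cN : {for v, continuous (fun v => (tiltN (c (enorm v)) (gauge_lat v))^-1)}.
  apply: ctV; first by rewrite gt_eqF// sqrtr_gt0 tiltN2_gt0// gauge_lat_le1.
  by rewrite /tiltN; ctac.
have cC : {for v, continuous (fun v => tiltC (c (enorm v)) (gauge_lat v))}.
  by rewrite /tiltC; exact: ctM.
have cK : {for v, continuous (fun v => tiltK (c (enorm v)) (gauge_lat v))}.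
  by rewrite /tiltK; exact: ctM.
by ctac.
Qed.

Lemma tilt_familyK b r v : b ^+ 2 = 1 -> v <> 0 ->
  tilt_family c (- b) r (tilt_family c b r v) = v.
Proof.
move=> b1 v0.
have h : tiltC (c r) (gauge_lat v) ^+ 2 +
    (b * tiltK (c r) (gauge_lat v)) ^+ 2 * axis_ratio (gauge_lat v) ^+ 2 = 1.
  by rewrite [(b * _) ^+ 2]exprMn b1 mul1r tilt_unit ?gauge_lat_le1.
by rewrite {1}/tilt_family gauge_lat_shear// mulNr shearK.
Qed.

Lemma tilt_auto : norm_auto (normalise (tilt_family c 1)) (normalise (tilt_family c (- 1))).
Proof.
apply: normalise_auto; [exact: tilt_familyP|exact: tilt_familyP| |] => r v v0.
  by apply: tilt_familyK; rewrite ?expr1n.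
by rewrite -{1}(opprK 1); apply: tilt_familyK; rewrite ?sqrrN ?expr1n.
Qed.

End Param.

(** Between the bounding ellipses of the caps, rounding turns the slide into a
rotation; on the caps both sides are the identity or the rotation by pi, which
commutes with stretching. *)
Lemma round_turn_tilt r v : v <> 0 -> roundness r = 4 / 5 ->
  flat_family r (roty (twist_angle (cyl_lat (round_family r v))) (round_family r v)) =
  tilt_family (fun=> 0) 1 0 v.
Proof.
move=> v0 d45; have [tC tK] := tilt0 (gauge_lat v).
rewrite /tilt_family tC tK mul1r.
have flatE phi w : flat_family r (roty phi w) = ((roty phi w).1.1, w.1.2,
    (roty phi w).2 * Num.max (roundness r) (axis_ratio (cyl_lat w))).
  by rewrite /flat_family cyl_lat_roty.
rewrite flatE max_round//; have M0 := round_max_gt0 r (axis_ratio (gauge_lat v)).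
have Mn : Num.max (roundness r) (axis_ratio (gauge_lat v)) != 0 by rewrite gt_eqF.
have cap : twist_angle (cyl_lat (round_family r v)) = twist_angle (gauge_lat v) ->
    sin (twist_angle (gauge_lat v)) = 0 ->
  ((roty (twist_angle (cyl_lat (round_family r v))) (round_family r v)).1.1,
   (round_family r v).1.2,
   (roty (twist_angle (cyl_lat (round_family r v))) (round_family r v)).2 *
   Num.max (roundness r) (axis_ratio (gauge_lat v))) =
  shear (cos (twist_angle (gauge_lat v))) (twist_slope (gauge_lat v)) (axis_ratio (gauge_lat v) ^+ 2) v.
  move=> -> s0; rewrite /shear /roty /twist_slope s0 /round_family/=.
  by congr (_, _, _); field; rewrite ?Mn ?gt_eqF ?max_axis_ratio_gt0.
have lats : 3 / 5 <= `|gauge_lat v| -> 3 / 5 <= `|cyl_lat (round_family r v)|.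
  by move=> h; apply: (le_trans h); apply: gauge_lat_round_le => //; rewrite d45 axis_ratio_le.
have w0 := round_neq0 (r := r) v0.
have sgn1 : Num.sg (gauge_lat v) = Num.sg v.1.2.
  by rewrite /gauge_lat sgrM sgrV (gtr0_sg (gauge_gt0 v0)) mulr1.
have sgn2 : Num.sg (cyl_lat (round_family r v)) = Num.sg v.1.2.
  by rewrite /cyl_lat sgrM sgrV (gtr0_sg (cyl_gt0 w0)) mulr1.
case: (twist_angle_cases (gauge_lat v)) => h.
- have e45 := axis_ratio_ge h.
  rewrite cyl_lat_round ?d45// /shear /roty /round_family/= ?d45 !(max_r e45).
  have := twist_slopeE (gauge_lat v).
  set S := sin _; set k := twist_slope _; set e := axis_ratio _ in e45 * => <-.
  have en : e != 0 by rewrite gt_eqF//; lra.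
  by congr (_, _, _); field.
- have y0 : gauge_lat v < 0 by lra.
  have l2 : cyl_lat (round_family r v) < 0 by rewrite -sgr_lt0 sgn2 -sgn1 sgr_lt0.
  have h2 : cyl_lat (round_family r v) <= - (3 / 5).
    by move: lats; rewrite !ltr0_norm// => lats; have : 3 / 5 <= - gauge_lat v; [|move/lats]; lra.
  by apply: cap; rewrite !twist_angle_lo ?sinpi.
- have y0 : 0 < gauge_lat v by lra.
  have l2 : 0 < cyl_lat (round_family r v) by rewrite -sgr_gt0 sgn2 -sgn1 sgr_gt0.
  have h2 : 3 / 5 <= cyl_lat (round_family r v).
    by move: lats; rewrite !gtr0_norm//; exact.
  by apply: cap; rewrite !twist_angle_hi ?sin0.
Qed.

End Tilting.

(** * Straight strands with radial ends *)
Section Pinching.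
Variable R : realType.
Implicit Types (v : R * R * R) (x X L : R).

(** A piecewise linear odd homeomorphism of [[-X, X]]: on [[0, X]] it has slope
[1 / 2] first and slope [L] up to the fixed end point [X]. *)
Definition pinch X L x :=
  Num.max (Num.min (x / 2) (L * (X + x) - X)) (X - L * (X - x)).
Definition unpinch X L x :=
  Num.min (Num.max (2 * x) ((X + x) / L - X)) (X - (X - x) / L).

Lemma pinch_pos X L x : 1 <= L -> 0 <= x <= X ->
  pinch X L x = Num.max (x / 2) (X - L * (X - x)).
Proof.
move=> L1 /andP[x0 xX]; rewrite /pinch min_l//.
have : 0 <= (L - 1) * (X + x) by rewrite mulr_ge0//; lra.
lra.
Qed.

Lemma unpinch_pos X L x : 1 <= L -> 0 <= x <= X ->
  unpinch X L x = Num.min (2 * x) (X - (X - x) / L).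
Proof.
move=> L1 /andP[x0 xX]; rewrite /unpinch max_l//.
have L0 : 0 < L by lra.
have : (X + x) / L <= X + x by rewrite ler_pdivrMr// ler_peMr//; lra.
lra.
Qed.

Lemma pinchN X L x : 1 <= L -> `|x| <= X -> pinch X L (- x) = - pinch X L x.
Proof.
move=> L1; rewrite ler_norml => /andP[x0 xX].
have h1 : 0 <= (L - 1) * (X + x) by rewrite mulr_ge0//; lra.
have h2 : 0 <= (L - 1) * (X - x) by rewrite mulr_ge0//; lra.
rewrite /pinch opprK.
by case: (leP (- x / 2)) => ?; case: (leP (x / 2)) => ?; do ?[case: leP => ?]; lra.
Qed.

Lemma unpinchN X L x : 1 <= L -> `|x| <= X -> unpinch X L (- x) = - unpinch X L x.
Proof.
move=> L1; rewrite ler_norml => /andP[x0 xX].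
have L0 : 0 < L by lra.
have h1 : (X + x) / L <= X + x by rewrite ler_pdivrMr// ler_peMr//; lra.
have h2 : (X - x) / L <= X - x by rewrite ler_pdivrMr// ler_peMr//; lra.
have h3 : 0 <= (X + x) / L by rewrite divr_ge0//; lra.
have h4 : 0 <= (X - x) / L by rewrite divr_ge0//; lra.
rewrite /unpinch opprK.
by case: (leP (2 * - x)) => ?; case: (leP (2 * x)) => ?; do ?[case: leP => ?]; lra.
Qed.

Lemma pinchK_pos X L x : 1 <= L -> 0 <= x <= X ->
  0 <= pinch X L x <= X /\ unpinch X L (pinch X L x) = x.
Proof.
move=> L1 x0X; have /andP[x0 xX] := x0X; have L0 : 0 < L by lra.
have Ln : L != 0 by rewrite gt_eqF.
rewrite pinch_pos//; set p := Num.max _ _.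
have h : 0 <= L * (X - x) by rewrite mulr_ge0//; lra.
have p0X : 0 <= p <= X by rewrite /p; case: (leP (x / 2)) => ?; apply/andP; split; lra.
split=> //; rewrite unpinch_pos// /p; case: (leP (x / 2)) => h2.
  rewrite (_ : (X - (X - L * (X - x))) / L = X - x); last by field.
  by rewrite min_r; lra.
rewrite min_l; first by field.
suff : (X - x / 2) / L <= X - x by lra.
by rewrite ler_pdivrMr//; lra.
Qed.

Lemma unpinchK_pos X L x : 1 <= L -> 0 <= x <= X ->
  0 <= unpinch X L x <= X /\ pinch X L (unpinch X L x) = x.
Proof.
move=> L1 x0X; have /andP[x0 xX] := x0X; have L0 : 0 < L by lra.
have Ln : L != 0 by rewrite gt_eqF.
rewrite unpinch_pos//; set p := Num.min _ _.
have h : 0 <= (X - x) / L by rewrite divr_ge0//; lra.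
have h1 : (X - x) / L <= X - x by rewrite ler_pdivrMr// ler_peMr//; lra.
have p0X : 0 <= p <= X by rewrite /p; case: (leP (2 * x)) => ?; apply/andP; split; lra.
split=> //; rewrite pinch_pos// /p; case: (leP (2 * x)) => h2; last first.
  rewrite (_ : X - L * (X - (X - (X - x) / L)) = x); last by field.
  by rewrite max_r//; lra.
rewrite max_l; first by field.
have : (X - x) / L <= X - 2 * x by lra.
by rewrite ler_pdivrMr//; lra.
Qed.

Lemma pinchK X L x : 1 <= L -> `|x| <= X ->
  `|pinch X L x| <= X /\ unpinch X L (pinch X L x) = x.
Proof.
move=> L1; wlog x0 : x / 0 <= x => [hw|] xX.
  have [/hw|/ltW x0] := leP 0 x; first exact.
  have [||h e] := hw (- x); rewrite ?oppr_ge0 ?normrN//.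
  move: h e; rewrite pinchN// normrN => ? h.
  by split=> //; apply: oppr_inj; rewrite -unpinchN.
move: (xX); rewrite ger0_norm// => xX'.
have [|/andP[p0 p1] e] := @pinchK_pos X L x L1; first exact/andP.
by rewrite ger0_norm.
Qed.

Lemma unpinchK X L x : 1 <= L -> `|x| <= X ->
  `|unpinch X L x| <= X /\ pinch X L (unpinch X L x) = x.
Proof.
move=> L1; wlog x0 : x / 0 <= x => [hw|] xX.
  have [/hw|/ltW x0] := leP 0 x; first exact.
  have [||h e] := hw (- x); rewrite ?oppr_ge0 ?normrN//.
  move: h e; rewrite unpinchN// normrN => ? h.
  by split=> //; apply: oppr_inj; rewrite -pinchN.
move: (xX); rewrite ger0_norm// => xX'.
have [|/andP[p0 p1] e] := @unpinchK_pos X L x L1; first exact/andP.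
by rewrite ger0_norm.
Qed.

Definition rt2 : R := (Num.sqrt 2)^-1.

Lemma rt2_gt0 : 0 < rt2. Proof. by rewrite invr_gt0 sqrtr_gt0. Qed.

Lemma sqr_rt2 : rt2 ^+ 2 = 1 / 2.
Proof. by rewrite exprVn sqr_sqrtr// div1r. Qed.

(** [chord v] is half the length of the chord of the ball through [v] in the
direction of x. *)
Definition chord v := Num.sqrt (1 - v.1.2 ^+ 2 - v.2 ^+ 2).
(** The slope is chosen so that the point of the untangle at height [y] moves to
[|x| = |y|], that is onto a spoke, or to [|x| = rt2 / 2] if this is larger.
The required value [(X - |y|) / (X - rt2)] with [X = chord v] has the form
0 / 0 at the marked points; in the plane [z = 0] it simplifies to the
expression below, where moreover [X + |y| >= 1]. *)
Definition pinch_slope v := 2 * (chord v + rt2) / Num.max 1 (chord v + `|v.1.2|).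

Lemma chord_ge0 v : 0 <= chord v. Proof. exact: sqrtr_ge0. Qed.

Lemma sqr_chord v : enorm v <= 1 -> chord v ^+ 2 = 1 - v.1.2 ^+ 2 - v.2 ^+ 2.
Proof.
move=> v1; rewrite sqr_sqrtr//.
have : enorm v ^+ 2 <= 1 by rewrite expr_le1// enorm_ge0.
by rewrite sqr_enorm /sqnorm; have := sqr_ge0 v.1.1; lra.
Qed.

Lemma rt2_ge : 1 <= 2 * rt2.
Proof. by have := rt2_gt0; have := sqr_rt2; nra. Qed.

Lemma pinch_slope_ge1 v : enorm v <= 1 -> 1 <= pinch_slope v.
Proof.
move=> v1; rewrite /pinch_slope ler_pdivlMr; last by rewrite lt_max ltr01.
have X0 := chord_ge0 v; have r1 := rt2_ge.
have [_ y1 _] := coord_le_enorm v.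
by rewrite mul1r ge_max; apply/andP; split; lra.
Qed.

Lemma ctchord (T : topologicalType) (F : T -> R * R * R) (x : T) :
  {for x, continuous F} -> {for x, continuous (fun s => chord (F s))}.
Proof. by move=> cF; rewrite /chord; ctac. Qed.

Definition pinch_map v :=
  (pinch (chord v) (pinch_slope v) v.1.1, v.1.2, v.2).
Definition unpinch_map v :=
  (unpinch (chord v) (pinch_slope v) v.1.1, v.1.2, v.2).

Lemma continuous_pinch_slope : continuous pinch_slope.
Proof.
move=> v; suff : {for v, continuous (fun v => 2 * (chord v + rt2) /
  Num.max 1 (chord v + `|v.1.2|))} by [].
have cc := ctchord (@ctid _ v).
apply: ctM; first by ctac.
by apply: ctV; [rewrite gt_eqF// lt_max ltr01|ctac].
Qed.

Lemma pinch_slope_gt0 v : 0 < pinch_slope v.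
Proof.
rewrite /pinch_slope divr_gt0// ?lt_max ?ltr01// mulr_gt0//.
by have := chord_ge0 v; have := rt2_gt0; lra.
Qed.

Lemma ball_chordP v x : enorm v <= 1 ->
  enorm (x, v.1.2, v.2) <= 1 <-> `|x| <= chord v.
Proof.
move=> v1; have := sqr_chord v1.
rewrite -[`|x| <= _](@ler_pXn2r _ 2)// ?nnegrE ?chord_ge0// real_normK ?num_real// => ->.
rewrite -[enorm _ <= _](@ler_pXn2r _ 2)// ?nnegrE ?enorm_ge0// expr1n sqr_enorm /sqnorm/=.
by split; lra.
Qed.

Lemma pinch_auto : ball_auto pinch_map unpinch_map.
Proof.
have cs := continuous_pinch_slope.
split.
- move=> v; suff : {for v, continuous (fun v =>
    (pinch (chord v) (pinch_slope v) v.1.1, v.1.2, v.2))} by [].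
  have cc := ctchord (@ctid _ v).
  have cv : {for v, continuous pinch_slope} by exact: cs.
  by rewrite /pinch; ctac.
- move=> v; suff : {for v, continuous (fun v =>
    (unpinch (chord v) (pinch_slope v) v.1.1, v.1.2, v.2))} by [].
  have cc := ctchord (@ctid _ v).
  have cv : {for v, continuous (fun v => (pinch_slope v)^-1)}.
    by apply: ctV; [rewrite gt_eqF// pinch_slope_gt0|exact: cs].
  by rewrite /unpinch; ctac.
- move=> v v1; have L1 := pinch_slope_ge1 v1.
  have xX : `|v.1.1| <= chord v by apply/(ball_chordP _ v1); case: v {L1} v1 => [[]].
  have [h e] := pinchK L1 xX; split; first exact/(ball_chordP _ v1).
  by rewrite /unpinch_map /pinch_map /= e; case: v {L1 v1 xX h e} => [[]].
- move=> v v1; have L1 := pinch_slope_ge1 v1.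
  have xX : `|v.1.1| <= chord v by apply/(ball_chordP _ v1); case: v {L1} v1 => [[]].
  have [h e] := unpinchK L1 xX; split; first exact/(ball_chordP _ v1).
  by rewrite /unpinch_map /pinch_map /= e; case: v {L1 v1 xX h e} => [[]].
Qed.

Lemma pinch_sphere v : enorm v = 1 -> pinch_map v = v.
Proof.
move=> v1; have v1' : enorm v <= 1 by rewrite v1.
have L1 := pinch_slope_ge1 v1'; have X0 := chord_ge0 v.
have : `|v.1.1| = chord v.
  have := sqr_chord v1'; have := sqr_enorm v; rewrite v1 expr1n /sqnorm => e1 e2.
  rewrite -sqrtr_sqr /chord; congr Num.sqrt; lra.
rewrite /pinch_map; case: v {v1 v1'} L1 X0 => [[x y] z]/=.
set X := chord _; set L := pinch_slope _ => L1 X0 xX.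
have pX : pinch X L X = X by rewrite pinch_pos ?lexx ?X0// max_r; lra.
congr (_, _, _); move: xX; have [x0|x0] := ger0P x => xX; first by rewrite xX.
by rewrite -[x]opprK xX pinchN ?pX// ger0_norm.
Qed.

Lemma pinch_rel_auto : rel_auto pinch_map.
Proof. by exists unpinch_map; [exact: pinch_auto|exact: pinch_sphere]. Qed.

Lemma enorm_planar (x y : R) : enorm (x, y, 0) = Num.sqrt (x ^+ 2 + y ^+ 2).
Proof. by rewrite /enorm /sqnorm/= expr0n/= addr0. Qed.

Lemma pinch_strand (y sgn : R) : sgn ^+ 2 = 1 -> `|y| <= rt2 ->
  pinch_map (sgn * rt2, y, 0) = (sgn * Num.max (rt2 / 2) `|y|, y, 0).
Proof.
move=> s1 yr; have r0 := rt2_gt0; have r2 := sqr_rt2.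
have y2 : y ^+ 2 <= 1 / 2.
  by rewrite -r2 -(real_normK (num_real y)) lerXn2r ?nnegrE ?(ltW r0).
have v1 : enorm (sgn * rt2, y, 0) <= 1.
  rewrite enorm_planar -[leRHS]sqrtr1 ler_wsqrtr// exprMn s1 r2; lra.
have := sqr_chord v1; have L1 := pinch_slope_ge1 v1; have X0 := chord_ge0 (sgn * rt2, y, 0).
rewrite /pinch_map/=; move: L1 X0; set X := chord _.
set L := pinch_slope _ => L1 X0; rewrite expr0n/= subr0 => X2.
have y0 := normr_ge0 y; have yy := real_normK (num_real y).
have rX : rt2 <= X by rewrite -(@ler_pXn2r _ 2)// ?nnegrE ?(ltW r0)// X2 r2; lra.
have XY1 : 1 <= X + `|y|.
  have : 0 <= X * `|y| by rewrite mulr_ge0.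
  by move=> ?; rewrite -(@ler_pXn2r _ 2)// ?nnegrE ?addr_ge0// expr1n sqrrD X2 yy; lra.
have LE : L * (X + `|y|) = 2 * (X + rt2).
  by rewrite /L /pinch_slope/= -/X max_r// divfK// gt_eqF//; lra.
(* Multiply by [X + |y|]: as [X^2 = 1 - y^2], both sides become [X^2 - y^2]. *)
have key : L * (X - rt2) = X - `|y|.
  have n0 : X + `|y| != 0 by rewrite gt_eqF//; lra.
  apply: (mulfI n0); rewrite mulrA [_ * L]mulrC LE.
  have -> : 2 * (X + rt2) * (X - rt2) = 2 * (X ^+ 2 - rt2 ^+ 2) by ring.
  have -> : (X + `|y|) * (X - `|y|) = X ^+ 2 - `|y| ^+ 2 by ring.
  by rewrite X2 r2 yy; field.
have pr : pinch X L rt2 = Num.max (rt2 / 2) `|y|.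
  by rewrite pinch_pos ?(ltW r0)// key; congr Num.max; ring.
congr (_, _, _); move/eqP: s1; rewrite sqrf_eq1 => /orP[/eqP->|/eqP->].
  by rewrite !mul1r.
by rewrite !mulN1r pinchN ?pr// gtr0_norm.
Qed.

End Pinching.

(** * The twist as the image of a homeomorphism *)
Section TwistHomeomorphism.
Variable R : realType.
Implicit Types (v : R * R * R) (a b s r : R) (A : set (R * R * R)).

Definition corners : set (R * R * R) :=
  [set v | exists a b, [/\ a ^+ 2 = 1, b ^+ 2 = 1 & v = rt2 R *: (a, b, 0)]].

Definition spokes : set (R * R * R) :=
  [set v | exists s a b, [/\ 0 <= s <= 1, a ^+ 2 = 1, b ^+ 2 = 1 &
    v = ((1 + s) / 2 * rt2 R) *: (a, b, 0)]].

(** The first half of the twist move: shrink, and join to the marked points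
without turning. *)
Definition add_spokes A := [set 2^-1 *: v | v in A] `|` spokes.

Lemma sqr1P a : a ^+ 2 = 1 -> a = 1 \/ a = - 1.
Proof. by move/eqP; rewrite sqrf_eq1 => /orP[/eqP|/eqP]; [left|right]. Qed.

Lemma cornersE : corners = [set point1 R; point2 R; point3 R; point4 R].
Proof.
apply/seteqP; split=> [v [a [b [/sqr1P[]-> /sqr1P[]-> ->]]]|v].
- by left; right.
- by left; left; right.
- by right.
- by left; left; left.
- by move=> [[[|]|]|] /= ->; [exists (- 1), (- 1)|exists 1, (- 1)|exists 1, 1|exists (- 1), 1];
    split; rewrite ?sqrrN ?expr1n.
Qed.

Lemma twist_shellE : shell_arc (@twist_end1 R) `|` shell_arc (@twist_end2 R)
    `|` shell_arc (@twist_end3 R) `|` shell_arc (@twist_end4 R) =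
  [set v | exists s a b, [/\ 0 <= s <= 1, a ^+ 2 = 1, b ^+ 2 = 1 &
    v = ((1 + s) / 2 * rt2 R) *: roty (s * twist_angle b) (a, b, 0)]].
Proof.
have hm : twist_angle (- 1 : R) = pi by rewrite twist_angle_lo//; lra.
have hp : twist_angle (1 : R) = 0 by rewrite twist_angle_hi//; lra.
apply/seteqP; split=> v.
  move=> [[[|]|]|] [s]; rewrite /= in_itv/= => s01 <-.
  - exists s, (- 1), (- 1); split; rewrite ?sqrrN ?expr1n// -[RHS]scalerA;
    rewrite /twist_end1 /twist_end2 /twist_end3 /twist_end4 /point3 /point4 -/(rt2 R);
    congr (_ *: (_ *: _)).
    by rewrite /roty/= hm mulrC; congr (_, _, _); ring.
  - exists s, 1, (- 1); split; rewrite ?sqrrN ?expr1n// -[RHS]scalerA;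
    rewrite /twist_end1 /twist_end2 /twist_end3 /twist_end4 /point3 /point4 -/(rt2 R);
    congr (_ *: (_ *: _)).
    by rewrite /roty/= hm mulrC; congr (_, _, _); ring.
  - exists s, 1, 1; split; rewrite ?sqrrN ?expr1n// -[RHS]scalerA;
    rewrite /twist_end1 /twist_end2 /twist_end3 /twist_end4 /point3 /point4 -/(rt2 R);
    congr (_ *: (_ *: _)).
    by rewrite /roty/= hp mulr0 cos0 sin0; congr (_, _, _); ring.
  - exists s, (- 1), 1; split; rewrite ?sqrrN ?expr1n// -[RHS]scalerA;
    rewrite /twist_end1 /twist_end2 /twist_end3 /twist_end4 /point3 /point4 -/(rt2 R);
    congr (_ *: (_ *: _)).
    by rewrite /roty/= hp mulr0 cos0 sin0; congr (_, _, _); ring.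
move=> [s [a [b [s01 /sqr1P a1 /sqr1P b1 ->]]]]; rewrite -scalerA.
have s01' : s \in `[0, 1] by rewrite in_itv.
case: b1 => ->; case: a1 => ->.
- left; right; exists s => //;
    rewrite /twist_end1 /twist_end2 /twist_end3 /twist_end4 /point3 /point4 -/(rt2 R);
    congr (_ *: (_ *: _)).
  by rewrite /roty/= hp mulr0 cos0 sin0; congr (_, _, _); ring.
- right; exists s => //;
    rewrite /twist_end1 /twist_end2 /twist_end3 /twist_end4 /point3 /point4 -/(rt2 R);
    congr (_ *: (_ *: _)).
  by rewrite /roty/= hp mulr0 cos0 sin0; congr (_, _, _); ring.
- left; left; right; exists s => //;
    rewrite /twist_end1 /twist_end2 /twist_end3 /twist_end4 /point3 /point4 -/(rt2 R);
    congr (_ *: (_ *: _)).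
  by rewrite /roty/= hm mulrC; congr (_, _, _); ring.
- left; left; left; exists s => //;
    rewrite /twist_end1 /twist_end2 /twist_end3 /twist_end4 /point3 /point4 -/(rt2 R);
    congr (_ *: (_ *: _)).
  by rewrite /roty/= hm mulrC; congr (_, _, _); ring.
Qed.

Lemma untangleE : untangle R =
  [set v | exists a (e : R), [/\ a ^+ 2 = 1, -1 <= e <= 1 & v = rt2 R *: (a, e, 0)]].
Proof.
apply/seteqP; split=> v.
  move=> [|] [t]; rewrite /= in_itv/= => /andP[t0 t1] <-.
    exists (- 1), (2 * t - 1); split; rewrite ?sqrrN ?expr1n//; first by apply/andP; split; lra.
    by rewrite /point1 /point4 -/(rt2 R) !scale3E; congr (_, _, _); rewrite /=; ring.
  exists 1, (2 * t - 1); split; rewrite ?expr1n//; first by apply/andP; split; lra.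
  by rewrite /point2 /point3 -/(rt2 R) !scale3E; congr (_, _, _); rewrite /=; ring.
move=> [a [e [/sqr1P a1 /andP[e0 e1] ->]]].
have h : (e + 1) / 2 \in `[0, 1] by rewrite in_itv/=; apply/andP; split; lra.
case: a1 => ->; [right|left]; exists ((e + 1) / 2) => //.
  by rewrite /point2 /point3 -/(rt2 R) !scale3E; congr (_, _, _); rewrite /=; field.
by rewrite /point1 /point4 -/(rt2 R) !scale3E; congr (_, _, _); rewrite /=; field.
Qed.

Lemma in_ball_untangle : in_ball (untangle R).
Proof.
rewrite untangleE => v [a [e [a1 e01 ->]]].
rewrite enormZ (gtr0_norm (rt2_gt0 R)) enorm_planar a1.
have e2 : e ^+ 2 <= 1 by nra.
rewrite -(@ler_pXn2r _ 2)// ?nnegrE ?mulr_ge0 ?sqrtr_ge0 ?(ltW (rt2_gt0 R))//.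
have e20 := sqr_ge0 e; rewrite exprMn sqr_sqrtr; last by lra.
by rewrite sqr_rt2 expr1n; lra.
Qed.

Lemma pinch_untangle : @pinch_map R @` untangle R = add_spokes (untangle R).
Proof.
have r0 := rt2_gt0 R; have r0' := ltW r0.
have pm a (e : R) : a ^+ 2 = 1 -> -1 <= e <= 1 ->
    pinch_map (rt2 R *: (a, e, 0)) = rt2 R *: (a * Num.max (1 / 2) `|e|, e, 0).
  move=> a1 e1; rewrite !scale3E/= mulr0 [rt2 R * a]mulrC pinch_strand//.
    rewrite normrM (gtr0_norm r0) (_ : rt2 R / 2 = rt2 R * (1 / 2)) -?maxr_pMr//; last by field.
    by rewrite mulrCA.
  by rewrite normrM (gtr0_norm r0) ger_pMr// ler_norml; case/andP: e1 => -> ->.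
rewrite /add_spokes untangleE; apply/seteqP; split=> v.
  move=> [_ [a [e [a1 e1 ->]]] <-]; rewrite pm//.
  have [h|h] := leP `|e| (1 / 2).
    left; exists (rt2 R *: (a, 2 * e, 0)).
      exists a, (2 * e); split=> //; move: h; rewrite ler_norml => /andP[? ?].
      by apply/andP; split; lra.
    by rewrite !scale3E/=; congr (_, _, _); field.
  right; exists (2 * `|e| - 1), a, (Num.sg e); split=> //.
  - have : `|e| <= 1 by rewrite ler_norml.
    by move=> ?; apply/andP; split; lra.
  - by rewrite sqr_sg; case: eqP h => // ->; rewrite normr0; lra.
  - rewrite !scale3E/= [(1 + _) / 2](_ : _ = `|e|); last by field.
    congr (_, _, _); [by ring| |by ring].
    by rewrite [in LHS](numEsg e); ring.
move=> [[_ [a [e [a1 e1 ->]]] <-]|[s [a [b [s01 a1 b1 ->]]]]].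
  have e2 : -1 <= e / 2 <= 1 by apply/andP; case/andP: e1 => ? ?; split; lra.
  exists (rt2 R *: (a, e / 2, 0)); first by exists a, (e / 2).
  rewrite pm// max_l; last by rewrite ler_norml; case/andP: e1 => ? ?; apply/andP; split; lra.
  by rewrite !scale3E/=; congr (_, _, _); field.
have nb : `|(1 + s) / 2 * b| = (1 + s) / 2.
  have s0 : 0 <= (1 + s) / 2 by case/andP: s01 => ? ?; lra.
  by case: (sqr1P b1) => ->; rewrite ?mulrN1 ?normrN ?mulr1 ger0_norm.
have e1 : -1 <= (1 + s) / 2 * b <= 1.
  by rewrite -ler_norml nb; case/andP: s01 => ? ?; lra.
exists (rt2 R *: (a, (1 + s) / 2 * b, 0)); first by exists a, ((1 + s) / 2 * b).
rewrite pm// nb max_r; last by case/andP: s01 => ? ?; lra.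
by rewrite !scale3E/=; congr (_, _, _); ring.
Qed.


Definition shell_rot := normalise (roty_family (@stage R)).
Definition full_rot := normalise (roty_family (fun=> 1 : R)).
Definition full_rotV := normalise (roty_family (fun=> - 1 : R)).
Definition tilt_stage := normalise (tilt_family (@stage R) 1).
Definition tilt_startV := normalise (tilt_family (fun=> 0 : R) (- 1)).
Definition pillow_twist := normalise (tilt_family (fun=> 1 : R) 1).
Definition pillow_twistV := normalise (tilt_family (fun=> 1 : R) (- 1)).
Notation round_map := (normalise (@round_family R)).
Notation flat_map := (normalise (@flat_family R)).

(** [shell_rot] alone carries the spokes to the arcs of the twist move.  The
composite of the other factors is the identity on the inner half ball and on
the spokes, and on the sphere it corrects [shell_rot], which is [full_rot]
there, to [pillow_twist]. *)
Definition twist_map := shell_rot \o (full_rotV \o (flat_map \o (full_rot \o (round_map \o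
  (tilt_startV \o tilt_stage))))).

Lemma stage_itv r : 0 <= stage r <= 1. Proof. exact: clamp01_itv. Qed.

Lemma continuous_stage : continuous (@stage R).
Proof.
move=> r; suff : {for r, continuous (fun r => stage r)} by [].
by apply: ctstage; exact: ctid.
Qed.

Lemma full_rot_auto : norm_auto full_rot full_rotV.
Proof. by apply: roty_family_auto; exact: cst_continuous. Qed.

Lemma tilt_start_auto :
  norm_auto (normalise (tilt_family (fun=> 0 : R) 1)) tilt_startV.
Proof. by apply: tilt_auto => [|r]; [exact: cst_continuous|rewrite lexx ler01]. Qed.

Lemma pillow_twist_auto : norm_auto pillow_twist pillow_twistV.
Proof. by apply: tilt_auto => [|r]; [exact: cst_continuous|rewrite lexx ler01]. Qed.

Lemma twist_map_auto : exists g, norm_auto twist_map g.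
Proof.
have h1 := tilt_auto continuous_stage stage_itv.
have h2 := norm_auto_comp h1 (norm_auto_sym tilt_start_auto).
have h3 := norm_auto_comp h2 (@round_auto R).
have h4 := norm_auto_comp h3 full_rot_auto.
have h5 := norm_auto_comp h4 (norm_auto_sym (@round_auto R)).
have h6 := norm_auto_comp h5 (norm_auto_sym full_rot_auto).
have h7 := norm_auto_comp h6 (roty_family_auto continuous_stage).
by eexists; exact: h7.
Qed.

Lemma stage1 : stage (1 : R) = 1.
Proof. by rewrite /stage clamp01_ge1//; lra. Qed.

Lemma stage_half r : r <= 1 / 2 -> stage r = 0.
Proof. by move=> h; rewrite /stage clamp01_le0//; lra. Qed.

(** On the sphere the flattened circular twist is the tilt at stage 0
([round_turn_tilt]), which cancels against [tilt_startV]. *)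
Lemma twist_map_sphere v : enorm v = 1 -> twist_map v = pillow_twist v.
Proof.
move=> v1; rewrite /twist_map /=.
have -> : tilt_stage v = pillow_twist v.
  by rewrite /tilt_stage /pillow_twist /normalise v1 /tilt_family stage1.
have [_ _ pn _ _] := pillow_twist_auto.
have w1 : enorm (pillow_twist v) = 1 by rewrite pn.
move: (pillow_twist v) w1 => w w1 {pn}.
have [_ _ sn sK tK] := tilt_start_auto.
have [_ _ tn _ _] := norm_auto_sym tilt_start_auto.
have := tK w; have : enorm (tilt_startV w) = 1 by rewrite tn.
move: (tilt_startV w) => u u1 uw.
have u0 : u <> 0 by move=> u0; move: u1; rewrite u0 enorm0; lra.
have E : flat_family (enorm u) (roty_family (fun=> 1) (enorm u)
    (round_family (enorm u) u)) = tilt_family (fun=> 0 : R) 1 (enorm u) u.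
  rewrite /roty_family mul1r round_turn_tilt//.
  by rewrite /roundness u1 stage1; field.
have -> : flat_map (full_rot (round_map u)) = w.
  have rn := round_neq0 (r := enorm u) u0.
  rewrite [full_rot _]normalise_comp//; last first.
    by apply: (roty_familyP _).1; exact: cst_continuous.
  rewrite normalise_comp; first by rewrite -uw /normalise /= E.
  - exact: (flat_familyP R).1.
  - by move=> _ /=; exact: roty_neq0.
have -> : shell_rot (full_rotV w) = full_rot (full_rotV w).
  rewrite /shell_rot /full_rot !normalise_roty /roty_family.
  have [_ _ fn _ _] := norm_auto_sym full_rot_auto.
  by rewrite fn w1 stage1.
by have [_ _ _ _ fK] := full_rot_auto; exact: fK.
Qed.

Lemma twist_map_inner v : enorm v <= 1 / 2 -> twist_map v = v.
Proof.
move=> v2; rewrite /twist_map /=.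
have s0 := stage_half v2.
have d1 : roundness (enorm v) = 1 by rewrite /roundness s0; field.
have -> : tilt_startV (tilt_stage v) = v.
  have -> : tilt_stage v = normalise (tilt_family (fun=> 0 : R) 1) v.
    by rewrite /tilt_stage /normalise /tilt_family s0.
  by have [_ _ _ sK _] := tilt_start_auto; exact: sK.
have -> : round_map v = v.
  by rewrite normalise_eq /round_family d1 max_l ?axis_ratio_le1// divr1; case: v {v2 s0 d1} => [[]].
have [_ _ fn fK _] := full_rot_auto.
have -> : flat_map (full_rot v) = full_rot v.
  by rewrite normalise_eq /flat_family fn d1 max_l ?axis_ratio_le1// mulr1 -?surjective_pairing.
by rewrite fK /shell_rot normalise_roty /roty_family s0 mul0r /roty cos0 sin0 !mulr0 !mulr1
  addr0 subr0; case: v {v2 s0 d1} => [[]].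
Qed.

Section Spoke.
Variables (l a b : R).
Hypotheses (l0 : 0 < l) (a1 : a ^+ 2 = 1) (b1 : b ^+ 2 = 1).

Lemma norm_unit (x : R) : x ^+ 2 = 1 -> `|x| = 1.
Proof. by move=> /sqr1P[]->; rewrite ?normrN normr1. Qed.

Lemma gauge_corner : gauge (l *: (a, b, 0)) = l.
Proof.
rewrite gaugeZ// (@gauge_unique _ _ 1) ?mulr1//= ?norm_unit//.
by rewrite a1 b1 !expr1n expr0n/= subrr !mul0r.
Qed.

Lemma cyl_corner : cyl (l *: (a, b, 0)) = l.
Proof.
rewrite cylZ// /cyl/= a1 expr0n/= addr0 sqrtr1 norm_unit// maxxx mulr1 //.
Qed.

Lemma gauge_lat_corner : gauge_lat (l *: (a, b, 0)) = b.
Proof. by rewrite /gauge_lat gauge_corner scale3E/= mulrAC divff ?mul1r// gt_eqF. Qed.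

Lemma cyl_lat_corner : cyl_lat (l *: (a, b, 0)) = b.
Proof. by rewrite /cyl_lat cyl_corner scale3E/= mulrAC divff ?mul1r// gt_eqF. Qed.

Lemma twist_angle_corner : cos (twist_angle b) = b /\ sin (twist_angle b) = 0.
Proof.
case: (sqr1P b1) => ->.
  by rewrite twist_angle_hi ?cos0 ?sin0//; lra.
by rewrite twist_angle_lo ?cospi ?sinpi//; lra.
Qed.

Lemma enorm_corner : enorm (l *: (a, b, 0)) = l * Num.sqrt 2.
Proof. by rewrite enormZ gtr0_norm// enorm_planar a1 b1. Qed.

(** The rays through the marked points lie on degenerate ellipses, where every
stage of the slide has the same effect. *)
Lemma tilt_corner c (sg : R) r :
  tilt_family c sg r (l *: (a, b, 0)) = l *: (a * b, b, 0).
Proof.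
have e0 : axis_ratio b = 0 by rewrite /axis_ratio b1 subrr sqrtr0.
have A : tiltA (c r) b = b by rewrite /tiltA twist_angle_corner.1; ring.
have N : tiltN (c r) b = 1.
  by rewrite /tiltN A b1 e0 expr0n/= mulr0 addr0 sqrtr1.
rewrite /tilt_family gauge_lat_corner /tiltC A N e0 divr1 /shear !scale3E/=.
by rewrite expr0n/= !mulr0 !mul0r !addr0 subr0 mulrA.
Qed.

Lemma roty_corner c r : roty_family c r (l *: (a, b, 0)) =
  l *: roty (c r * twist_angle b) (a, b, 0).
Proof. by rewrite /roty_family cyl_lat_corner rotyZ. Qed.

End Spoke.

Lemma sqr_mul1 a b : a ^+ 2 = 1 -> b ^+ 2 = 1 -> (a * b) ^+ 2 = 1.
Proof. by move=> a1 b1; rewrite exprMn a1 b1 mulr1. Qed.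

Lemma twist_map_spoke s a b : 0 <= s <= 1 -> a ^+ 2 = 1 -> b ^+ 2 = 1 ->
  twist_map (((1 + s) / 2 * rt2 R) *: (a, b, 0)) =
  ((1 + s) / 2 * rt2 R) *: roty (s * twist_angle b) (a, b, 0).
Proof.
move=> /andP[s0 s1] a1 b1; set l := _ * rt2 R.
have l0 : 0 < l by rewrite mulr_gt0 ?rt2_gt0//; lra.
have ab1 := sqr_mul1 a1 b1.
have abb : a * b * b = a by rewrite -mulrA -expr2 b1 mulr1.
have nE : enorm (l *: (a, b, 0)) = (1 + s) / 2.
  by rewrite enorm_corner// -mulrA mulVf ?mulr1// gt_eqF// sqrtr_gt0.
have tc c sg a' : a' ^+ 2 = 1 -> normalise (tilt_family c sg) (l *: (a', b, 0)) =
    l *: (a' * b, b, 0).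
  move=> a'1; rewrite normalise_eq tilt_corner//.
  by rewrite !enorm_corner// sqr_mul1.
rewrite /twist_map /=.
have -> : tilt_startV (tilt_stage (l *: (a, b, 0))) = l *: (a, b, 0).
  by rewrite /tilt_startV /tilt_stage !tc// abb.
have rc a' : round_map (l *: (a', b, 0)) = l *: (a', b, 0).
  by rewrite normalise_eq /round_family !scale3E/= !mulr0 mul0r.
have fc a' : flat_map (l *: (a', b, 0)) = l *: (a', b, 0).
  by rewrite normalise_eq /flat_family !scale3E/= !mulr0 mul0r.
have [hc hs] := twist_angle_corner b1.
have rotc a' : a' ^+ 2 = 1 -> full_rot (l *: (a', b, 0)) = l *: (a' * b, b, 0).
  move=> a'1; rewrite /full_rot normalise_roty roty_corner// mul1r /roty/= hc hs.
  by rewrite !mulr0 !mul0r addr0 subr0.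
rewrite rc rotc// fc.
have -> : full_rotV (l *: (a * b, b, 0)) = l *: (a, b, 0).
  by rewrite -(rotc a)//; have [_ _ _ fK _] := full_rot_auto; rewrite fK.
rewrite /shell_rot normalise_roty roty_corner// nE.
congr (_ *: roty (_ * _) _); rewrite /stage clamp01_id; first by field.
by apply/andP; split; lra.
Qed.

Lemma twist_expand A : in_ball A -> Defs.twist A = twist_map @` add_spokes A.
Proof.
move=> Ab; rewrite /Defs.twist twist_shellE /add_spokes image_setU; congr (_ `|` _).
  apply/seteqP; split=> _ [v Av <-].
    exists (2^-1 *: v); first by exists v.
    rewrite twist_map_inner// enormZ gtr0_norm ?invr_gt0//.
    by have := Ab _ Av; lra.
  case: Av => w Aw <-; exists w => //.
  rewrite twist_map_inner// enormZ gtr0_norm ?invr_gt0//.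
  by have := Ab _ Aw; lra.
apply/seteqP; split=> v.
  move=> [s [a [b [s01 a1 b1 ->]]]].
  exists (((1 + s) / 2 * rt2 R) *: (a, b, 0)); first by exists s, a, b.
  exact: twist_map_spoke.
move=> [_ [s [a [b [s01 a1 b1 ->]]]] <-].
by exists s, a, b; split=> //; exact: twist_map_spoke.
Qed.

End TwistHomeomorphism.

(** * Moves on isotopy classes *)
Section MovesOnClasses.
Variable R : realType.
Implicit Types (u v w : R * R * R) (a b s t : R) (A B : set (R * R * R)).
Implicit Types (h g k : R * R * R -> R * R * R).

Definition turn_map v : R * R * R := (- v.1.2, v.1.1, v.2).
Definition turn_mapV v : R * R * R := (v.1.2, - v.1.1, v.2).

Lemma turn_auto : norm_auto turn_map turn_mapV.
Proof.
split.
- move=> v; suff : {for v, continuous (fun v : R * R * R => (- v.1.2, v.1.1, v.2))} by [].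
  by ctac.
- move=> v; suff : {for v, continuous (fun v : R * R * R => (v.1.2, - v.1.1, v.2))} by [].
  by ctac.
- by move=> v; rewrite /enorm /sqnorm/= sqrrN [X in X + _]addrC.
- by move=> [[x y] z]; rewrite /turn_mapV/= opprK.
- by move=> [[x y] z]; rewrite /turn_map/= opprK.
Qed.

Lemma rel_auto_id : rel_auto (@id (R * R * R)).
Proof. by exists id => //; apply: norm_auto_ball; exact: norm_auto_id. Qed.

Lemma move_in_ball m A : in_ball A -> in_ball (move_rep m A).
Proof.
case: m => Ab; last first.
  by move=> _ [v Av <-]; have [_ _ tn _ _] := turn_auto; rewrite tn; exact: Ab.
rewrite /move_rep twist_expand//; have [g tg] := twist_map_auto R.
apply: in_ball_image (norm_auto_ball tg) _ => u [[v Av <-]|].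
  by rewrite enormZ gtr0_norm ?invr_gt0//; have := Ab _ Av; lra.
move=> [s [a [b [/andP[s0 s1] a1 b1 ->]]]].
have r0 := rt2_gt0 R.
rewrite enorm_corner//; last by rewrite mulr_gt0//; lra.
by rewrite -mulrA mulVf ?gt_eqF ?sqrtr_gt0//; lra.
Qed.

(** Moves respect isotopy: for the twist, the homeomorphism is conjugated by the
shrinking and extended by the identity, which is the Alexander isotopy at time
[1 / 2]. *)
Lemma move_rel m k A : rel_auto k -> in_ball A ->
  exists2 k', rel_auto k' & k' @` move_rep m A = move_rep m (k @` A).
Proof.
move=> [g kg kf] Ab; case: m; last first.
  exists (turn_map \o (k \o turn_mapV)).
    have tb := norm_auto_ball turn_auto.
    exists (turn_map \o g \o turn_mapV).
      by apply: ball_auto_comp (ball_auto_comp (ball_auto_sym tb) kg) tb.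
    move=> v v1; have [_ _ tn tK Kt] := turn_auto.
    by rewrite /= kf ?Kt//; have [_ _ -> _ _] := norm_auto_sym turn_auto.
  have [_ _ _ tK _] := turn_auto.
  apply/seteqP; split=> _ [_ [v Av <-] <-].
    by exists (k v); [exists v|rewrite /= tK].
  by exists (turn_map v); [exists v|rewrite /= tK].
have h01 : 0 <= (2^-1 : R) <= 1 by apply/andP; split; lra.
have h0 : 0 < (2^-1 : R) by lra.
exists (fun v => alexander k (2^-1, v)).
  exists (fun v => alexander g (2^-1, v)); first exact: alexander_auto.
  by move=> v v1; exact: alexander_fix.
rewrite /move_rep /Defs.twist twist_shellE image_setU; congr (_ `|` _).
  have half v : A v -> alexander k (2^-1, 2^-1 *: v) = 2^-1 *: k v.
    move=> /Ab v1; rewrite alexander_small//; last by rewrite enormZ gtr0_norm//; lra.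
    by rewrite invrK scalerA divff// scale1r.
  apply/seteqP; split=> _ [_ [v Av <-] <-].
    by exists (k v); [exists v|rewrite half].
  by exists (2^-1 *: v); [exists v|rewrite half].
have shell s a b : 0 <= s <= 1 -> a ^+ 2 = 1 -> b ^+ 2 = 1 ->
  alexander k (2^-1, ((1 + s) / 2 * rt2 R) *: roty (s * twist_angle b) (a, b, 0))
   = ((1 + s) / 2 * rt2 R) *: roty (s * twist_angle b) (a, b, 0).
  move=> /andP[s0 s1] a1 b1; apply: alexander_big => //.
  have r0 := rt2_gt0 R.
  rewrite -rotyZ enorm_roty enorm_corner//; last by rewrite mulr_gt0//; lra.
  by rewrite -mulrA mulVf ?gt_eqF ?sqrtr_gt0//; lra.
apply/seteqP; split=> v.
  by move=> [_ [s [a [b [s01 a1 b1 ->]]]] <-]; exists s, a, b; rewrite shell.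
move=> [s [a [b [s01 a1 b1 ->]]]]; rewrite -shell//.
by eexists; last reflexivity; exists s, a, b.
Qed.

Lemma isotopic_refl A : in_ball A -> isotopic A A.
Proof.
by move=> Ab; rewrite -[X in isotopic _ X]image_id; apply: rel_auto_isotopic Ab; exact: rel_auto_id.
Qed.

Lemma move_class_tangle m A : in_ball A -> is_tangle A ->
  move_class m (tangle_class A) = tangle_class (move_rep m A).
Proof.
move=> Ab tA; have mb := move_in_ball (m := m) Ab.
apply/seteqP; split=> C; last first.
  by move=> CA; exists A => //; split=> //; exact: isotopic_refl.
move=> [B [tB /(isotopic_rel_auto Ab) [k ka ->]]].
have [k' ka' <-] := move_rel m ka Ab.
by rewrite -tangle_class_rel_auto.
Qed.

End MovesOnClasses.

(** * Moves as radial homeomorphisms *)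
Section ConeMaps.
Variable R : realType.
Implicit Types (u v w : R * R * R) (a b s t : R) (A B : set (R * R * R)).
Implicit Types (h g k : R * R * R -> R * R * R).

(** These maps send [add_spokes A] to [add_spokes] of the image of [A]. *)
Definition cone_auto h := [/\ exists g, norm_auto h g,
  forall a v, 0 < a -> h (a *: v) = a *: h v & h @` @corners R = @corners R].

Lemma cone_id : cone_auto id.
Proof.
by split=> //; [exists id; exact: norm_auto_id|rewrite image_id].
Qed.

Lemma cone_comp h k : cone_auto h -> cone_auto k -> cone_auto (k \o h).
Proof.
move=> [[g hg] hZ hc] [[g' kg] kZ kc]; split.
- by exists (g \o g'); exact: norm_auto_comp.
- by move=> a v a0; rewrite /= hZ// kZ.
- by rewrite -image_comp hc kc.
Qed.

Lemma cone_turn : cone_auto (@turn_map R).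
Proof.
split; first by exists (@turn_mapV R); exact: turn_auto.
  by move=> a v _; rewrite !scale3E /turn_map/= mulrN.
apply/seteqP; split=> v.
  move=> [_ [a [b [a1 b1 ->]]] <-]; exists (- b), a; rewrite sqrrN; split=> //.
  by rewrite /turn_map !scale3E/= mulrN.
move=> [a [b [a1 b1 ->]]]; exists (rt2 R *: (b, - a, 0)).
  by exists b, (- a); rewrite sqrrN.
by rewrite /turn_map !scale3E/= mulrN opprK.
Qed.

Lemma pillow_twistE v : pillow_twist v =
  (enorm v / enorm (tilt_family (fun=> 1) 1 0 v)) *: tilt_family (fun=> 1) 1 0 v.
Proof. by []. Qed.

Lemma pillow_twist_corner a b : a ^+ 2 = 1 -> b ^+ 2 = 1 ->
  pillow_twist (rt2 R *: (a, b, 0)) = rt2 R *: (a * b, b, 0).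
Proof.
move=> a1 b1; have r0 := rt2_gt0 R.
rewrite pillow_twistE tilt_corner// !enorm_corner// ?sqr_mul1//.
by rewrite divff ?scale1r// gt_eqF// mulr_gt0// sqrtr_gt0.
Qed.

Lemma cone_pillow_twist : cone_auto (@pillow_twist R).
Proof.
split; first by exists (@pillow_twistV R); exact: pillow_twist_auto.
  move=> a v a0; rewrite !pillow_twistE.
  have -> : tilt_family (fun=> 1) 1 0 (a *: v) = a *: tilt_family (fun=> 1) 1 0 v.
    by rewrite /tilt_family gauge_latZ// shearZ.
  rewrite !enormZ -mulf_div divff ?mul1r ?scalerA 1?mulrC//.
  by rewrite gtr0_norm// gt_eqF.
apply/seteqP; split=> v.
  move=> [_ [a [b [a1 b1 ->]]] <-]; rewrite pillow_twist_corner//.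
  by exists (a * b), b; rewrite sqr_mul1.
move=> [a [b [a1 b1 ->]]]; exists (rt2 R *: (a * b, b, 0)).
  by exists (a * b), b; rewrite sqr_mul1.
by rewrite pillow_twist_corner ?sqr_mul1// -mulrA -expr2 b1 mulr1.
Qed.

Lemma cone_spokes h A : cone_auto h -> h @` add_spokes A = add_spokes (h @` A).
Proof.
move=> [_ hZ hc]; rewrite /add_spokes image_setU; congr (_ `|` _).
  apply/seteqP; split=> _ [_ [v Av <-] <-].
    by exists (h v); [exists v|rewrite hZ].
  by exists (2^-1 *: v); [exists v|rewrite hZ].
have hcor a b : a ^+ 2 = 1 -> b ^+ 2 = 1 -> @corners R (h (rt2 R *: (a, b, 0))).
  by move=> a1 b1; rewrite -hc; exists (rt2 R *: (a, b, 0)) => //; exists a, b.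
have s0 s : 0 <= s <= 1 -> 0 < (1 + s) / 2 by case/andP => *; lra.
apply/seteqP; split=> v.
  move=> [_ [s [a [b [s01 a1 b1 ->]]]] <-].
  rewrite -scalerA hZ ?s0//; have [a' [b' [a1' b1' ->]]] := hcor a b a1 b1.
  by exists s, a', b'; rewrite scalerA.
move=> [s [a [b [s01 a1 b1 ->]]]]; rewrite -scalerA.
have : @corners R (rt2 R *: (a, b, 0)) by exists a, b.
rewrite -{1}hc => -[_ [a' [b' [a1' b1' ->]]] <-].
exists (((1 + s) / 2 * rt2 R) *: (a', b', 0)); first by exists s, a', b'.
by rewrite -scalerA hZ ?s0.
Qed.

Definition move_map (m : move) : R * R * R -> R * R * R :=
  match m with Twist => @pillow_twist R | Turn => @turn_map R end.

Lemma cone_move m : cone_auto (move_map m).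
Proof. by case: m; [exact: cone_pillow_twist|exact: cone_turn]. Qed.

Lemma in_ball_cone h : cone_auto h -> in_ball (h @` untangle R).
Proof.
move=> [[g hg] _ _]; apply: in_ball_image (norm_auto_ball hg) _.
exact: in_ball_untangle.
Qed.

(** Both tangles are images of the untangle under homeomorphisms of the ball that
agree on the sphere. *)
Lemma move_cone m h : cone_auto h -> exists2 k, rel_auto k &
  k @` ((move_map m \o h) @` untangle R) = move_rep m (h @` untangle R).
Proof.
move=> hh; have hb := in_ball_cone hh; have [[g hg] _ _] := hh.
case: m; last first.
  by exists id; [exact: rel_auto_id|rewrite image_id -image_comp].
rewrite /move_rep twist_expand// -cone_spokes// -pinch_untangle /=.
have [tV ttV] := twist_map_auto R; have pp := pillow_twist_auto R.
have [pi' pa pf] := pinch_rel_auto R.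
exists (@twist_map R \o (h \o (@pinch_map R \o (g \o @pillow_twistV R)))).
  eexists.
    apply: ball_auto_comp (norm_auto_ball ttV).
    apply: ball_auto_comp (norm_auto_ball hg).
    apply: ball_auto_comp pa.
    apply: ball_auto_comp (norm_auto_ball (norm_auto_sym hg)).
    exact: norm_auto_ball (norm_auto_sym pp).
  move=> v v1 /=.
  have [_ _ gn gK hK] := norm_auto_sym hg; have [_ _ pn pK pVK] := norm_auto_sym pp.
  have [_ _ hn _ _] := hg.
  have w1 : enorm (g (pillow_twistV v)) = 1 by rewrite gn pn.
  by rewrite pf// gK twist_map_sphere ?pn// pK.
have [_ _ _ pK _] := pp; have [_ _ _ hK _] := hg.
have E v : g (pillow_twistV (pillow_twist (h v))) = v.
  exact: etrans (congr1 g (pK (h v))) (hK v).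
rewrite [LHS]image_comp [X in _ = _ @` X]image_comp [RHS]image_comp.
refine (congr1 (fun f => f @` untangle R) _); apply/funext => v.
exact: (congr1 (@twist_map R \o (h \o @pinch_map R)) (E v)).
Qed.

End ConeMaps.

(** * Words of moves on the pillowcase *)
Section RationalTangles.
Variable R : realType.
Implicit Types (u v w : R * R * R) (a b s t : R) (A B : set (R * R * R)).
Implicit Types (h g k : R * R * R -> R * R * R).

Definition strand a t : R * R * R := rt2 R *: (a, 2 * t - 1, 0).

Lemma strand_segment a : segment (rt2 R *: (a, -1, 0)) (rt2 R *: (a, 1, 0)) =
  strand a @` `[0, 1].
Proof.
apply/seteqP; split=> _ [t t01 <-]; exists t => //;
  by rewrite /strand !scale3E; congr (_, _, _); rewrite /=; ring.
Qed.

Lemma strand_inj a : injective (strand a).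
Proof.
move=> s t; rewrite /strand !scale3E/= => -[] /(mulfI (lt0r_neq0 (rt2_gt0 R))); lra.
Qed.

Lemma enorm_strand_le a t : a ^+ 2 = 1 -> 0 <= t <= 1 -> enorm (strand a t) <= 1.
Proof.
move=> a1 /andP[t0 t1]; apply: in_ball_untangle; rewrite untangleE.
by exists a, (2 * t - 1); split=> //; apply/andP; split; lra.
Qed.

Lemma enorm_strand_eq1 a t : a ^+ 2 = 1 -> 0 <= t <= 1 ->
  enorm (strand a t) = 1 <-> t = 0 \/ t = 1.
Proof.
move=> a1 t01; have e2 : enorm (strand a t) ^+ 2 = (1 + (2 * t - 1) ^+ 2) / 2.
  by rewrite sqr_enorm sqnormZ sqr_rt2 /sqnorm/= a1; field.
split=> [e1|t0].
  have /eqP : t * (t - 1) = 0 by move: e2; rewrite e1 expr1n; nra.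
  by rewrite mulf_eq0 => /orP[/eqP|/eqP ?]; [left|right; lra].
apply/eqP; rewrite -(@pexpr_eq1 _ _ 2) ?enorm_ge0// e2.
by case: t0 => ->; apply/eqP; field.
Qed.

Lemma proper_arc_strand h g a : norm_auto h g -> a ^+ 2 = 1 ->
  proper_arc (h \o strand a).
Proof.
move=> [ch cg hn hg gh] a1; split.
- apply: continuous_subspaceT => t; apply: (ctcomp (F := strand a) ch).
  by rewrite /strand; apply: ctZv; [exact: ctC|ctac].
- by move=> s t _ _ /= /(can_inj hg); exact: strand_inj.
- move=> t; rewrite in_itv/= => t01; apply/unit_ballP; rewrite hn.
  exact: enorm_strand_le.
- move=> t; rewrite in_itv/= => t01.
  have e := enorm_strand_eq1 a1 t01; split.
    by move=> /unit_sphereP; rewrite /= hn => /e.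
  by move=> /e t0; apply/unit_sphereP; rewrite /= hn.
Qed.

Lemma tame_strand h g a : norm_auto h g -> tame ((h \o strand a) @` `[0, 1]).
Proof.
move=> hg; exists g; first exact/ball_auto_homeo/norm_auto_ball/norm_auto_sym/hg.
exists [:: (rt2 R *: (a, -1, 0), rt2 R *: (a, 1, 0))].
have [_ _ _ hgK _] := hg.
apply/seteqP; split=> v.
  move=> [_ [t t01 <-] <-]; exists (rt2 R *: (a, -1, 0), rt2 R *: (a, 1, 0)).
    by rewrite /= inE.
  by rewrite /= strand_segment hgK; exists t.
move=> [ab]; rewrite /= inE => /eqP -> /=; rewrite strand_segment => -[t t01 <-].
by exists (h (strand a t)); [exists t|rewrite /= hgK].
Qed.

Lemma untangle_strands : untangle R =
  (strand (- 1) @` `[0, 1]) `|` (strand 1 @` `[0, 1]).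
Proof. by rewrite -!strand_segment. Qed.

(** Without this the classes in the computation could be empty.  Tameness is clear
for images of straight segments under homeomorphisms of the ball. *)
Lemma is_tangle_cone h : cone_auto h -> is_tangle (h @` untangle R).
Proof.
move=> [[g hg] _ hc]; exists (h \o strand (- 1)), (h \o strand 1).
have n1 : (- 1) ^+ 2 = 1 :> R by rewrite sqrrN expr1n.
have p1 : 1 ^+ 2 = 1 :> R by rewrite expr1n.
have [_ _ _ hgK _] := hg.
split.
- by split; apply: (proper_arc_strand hg).
- by split; apply: (tame_strand _ hg).
- apply/seteqP; split=> // v [[t _ <-] [s _ /= /(can_inj hgK)]].
  rewrite /strand !scale3E/= => -[] /(mulfI (lt0r_neq0 (rt2_gt0 R))); lra.
- rewrite -cornersE -hc cornersE.
  have s00 : strand (- 1) 0 = point1 R by rewrite /strand mulr0 add0r.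
  have s01 : strand (- 1) 1 = point4 R.
    by rewrite /strand (_ : 2 * 1 - 1 = 1)//; ring.
  have s10 : strand 1 0 = point2 R by rewrite /strand mulr0 add0r.
  have s11 : strand 1 1 = point3 R.
    by rewrite /strand (_ : 2 * 1 - 1 = 1)//; ring.
  rewrite !image_setU !image_set1 /= s00 s01 s10 s11.
  rewrite -!setUA; congr (_ `|` _); rewrite setUC -!setUA; congr (_ `|` _).
- by rewrite untangle_strands image_setU !image_comp.
Qed.

Definition word_map (ms : seq move) : R * R * R -> R * R * R :=
  foldl (fun h m => move_map m \o h) id ms.

Lemma word_map_rcons ms m : word_map (rcons ms m) = move_map m \o word_map ms.
Proof. by rewrite /word_map foldl_rcons. Qed.

Lemma cone_word ms : cone_auto (word_map ms).
Proof.
elim/last_ind: ms => [|ms m IH]; first exact: cone_id.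
by rewrite word_map_rcons; apply: cone_comp => //; exact: cone_move.
Qed.

Lemma rational_tangle_word ms :
  rational_tangle R ms = tangle_class (word_map ms @` untangle R).
Proof.
elim/last_ind: ms => [|ms m IH]; first by rewrite /word_map /= image_id.
have hc := cone_word ms.
rewrite /rational_tangle foldl_rcons -/(rational_tangle R ms) IH word_map_rcons.
rewrite move_class_tangle; [|exact: in_ball_cone|exact: is_tangle_cone].
have [k ka <-] := move_cone m hc.
rewrite -tangle_class_rel_auto//.
by apply: in_ball_cone; apply: cone_comp => //; exact: cone_move.
Qed.

(** The universal cover of the pillowcase, branched over its four corners. *)
Definition pillow (X Y : R) : R * R * R := (cos X, cos Y, sin X * sin Y).

Lemma sqr_cos (x : R) : cos x ^+ 2 = 1 - sin x ^+ 2.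
Proof. by rewrite -(cos2Dsin2 x) addrK. Qed.

Lemma norm_cos_le1 (x : R) : `|cos x| <= 1.
Proof.
by rewrite -(@ler_pXn2r _ 2)// ?nnegrE// real_normK ?num_real// sqr_cos expr1n gerBl sqr_ge0.
Qed.

Lemma gauge_pillow X Y : gauge (pillow X Y) = 1.
Proof.
apply: gauge_unique => //=; rewrite ?norm_cos_le1//.
by rewrite !sqr_cos exprMn; ring.
Qed.

Lemma pillow_twist_pillow X Y : exists2 l, 0 < l &
  pillow_twist (pillow X Y) = l *: pillow (X - Y) Y.
Proof.
have neq0 X' Y' : pillow X' Y' <> 0.
  move=> p0; have := gauge_pillow X' Y'; rewrite p0 => g.
  have := gaugeZ (0 : R * R * R) (ltr0Sn R 1); rewrite scaler0 g; lra.
have l1 : gauge_lat (pillow X Y) = cos Y by rewrite /gauge_lat gauge_pillow divr1.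
rewrite pillow_twistE.
have -> : tilt_family (fun=> 1) 1 0 (pillow X Y) = pillow (X - Y) Y.
  rewrite /tilt_family l1; have [-> ->] := tilt1 (norm_cos_le1 Y).
  rewrite sqr_axis_ratio ?norm_cos_le1// sqr_cos /shear /pillow/= cosB sinB.
  by congr (_, _, _); ring.
by eexists; last reflexivity; rewrite divr_gt0// enorm_gt0.
Qed.

Lemma turn_pillow X Y : turn_map (pillow X Y) = pillow (pi - Y) X.
Proof.
by rewrite /turn_map /pillow/= cosB sinB cospi sinpi; congr (_, _, _); ring.
Qed.

(** The slope of a column [(m, n)], with the sign that makes T act as
[x |-> x + 1]. *)
Definition slope (m n : int) : option rat :=
  if n == 0 then None else Some (- (m%:~R / n%:~R)).

Lemma word_pillow ms : exists m11 m12 m21 m22 al be : int,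
  [/\ m11 * m22 - m12 * m21 = 1, tangle_invariant ms = slope m12 m22 &
   forall X Y, exists2 l, 0 < l & word_map ms (pillow X Y) =
     l *: pillow (m11%:~R * X + m12%:~R * Y + al%:~R * pi)
                 (m21%:~R * X + m22%:~R * Y + be%:~R * pi)].
Proof.
elim/last_ind: ms => [|ms m [m11 [m12 [m21 [m22 [al [be [det inv IH]]]]]]]].
  exists 1, 0, 0, 1, 0, 0; split => [//|//|X Y]; exists 1 => //.
  by rewrite /word_map/= scale1r !mul1r !mul0r !addr0 add0r.
have inv' : tangle_invariant (rcons ms m) = invariant_step (slope m12 m22) m.
  by rewrite /tangle_invariant foldl_rcons -/(tangle_invariant ms) inv.
case: m inv' => inv'.
  exists (m11 - m21), (m12 - m22), m21, m22, (al - be), be; split.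
  - by rewrite -det; ring.
  - rewrite inv' /slope; case: eqP => // /eqP n0 /=; congr Some.
    have n0' : m22%:~R != 0 :> rat by rewrite intr_eq0.
    by rewrite rmorphB/=; field.
  - move=> X Y; have [l l0 e] := IH X Y.
    rewrite word_map_rcons /= e; have [_ hZ _] := cone_pillow_twist R; rewrite hZ//.
    set X' := _ + al%:~R * pi; set Y' := _ + be%:~R * pi.
    have [l' l'0 ->] := pillow_twist_pillow X' Y'.
    exists (l * l'); first exact: mulr_gt0.
    rewrite scalerA; congr (_ *: pillow _ _); rewrite /X' /Y' !rmorphB/=; ring.
exists (- m21), (- m22), m11, m12, (1 - be), al; split.
- by rewrite -det; ring.
- rewrite inv' /slope; have [n0|n0] := eqVneq m22 0.
    rewrite /= ifF ?n0 ?oppr0 ?mul0r ?oppr0//; apply/negP => /eqP m0.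
    by move: det; rewrite n0 m0 mulr0 mul0r.
  have n0' : m22%:~R != 0 :> rat by rewrite intr_eq0.
  rewrite /= oppr_eq0 mulf_eq0 invr_eq0 (negbTE n0') orbF intr_eq0.
  case: eqP => // /eqP m0; congr Some; rewrite rmorphN/=.
  have m0' : m12%:~R != 0 :> rat by rewrite intr_eq0.
  by field; rewrite m0'.
- move=> X Y; have [l l0 e] := IH X Y.
  rewrite word_map_rcons /= e; have [_ hZ _] := cone_turn R; rewrite hZ//.
  rewrite turn_pillow; exists l => //; congr (_ *: pillow _ _).
  by rewrite !rmorphN rmorphB/=; ring.
Qed.

Lemma sin_int_pi (n : int) : sin (n%:~R * pi) = 0 :> R.
Proof.
have sn (m : nat) : sin (m%:R * pi) = 0 :> R.
  elim: m => [|m IH]; first by rewrite mul0r sin0.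
  by rewrite -addn1 natrD mulrDl mul1r sinDpi IH oppr0.
case: n => n; first exact: sn.
by rewrite NegzE rmorphN mulNr sinN [sin _](sn n.+1) oppr0.
Qed.

Lemma cos_int_pi (n : int) : cos (n%:~R * pi) ^+ 2 = 1 :> R.
Proof. by rewrite sqr_cos sin_int_pi expr0n subr0. Qed.

Lemma cosD_int_pi (x : R) (n : int) : cos (x + n%:~R * pi) = cos x * cos (n%:~R * pi).
Proof. by rewrite cosD sin_int_pi mulr0 subr0. Qed.

Lemma pillow_strand (n : int) (e : R) : -1 <= e <= 1 ->
  pillow (n%:~R * pi) (acos e) = (cos (n%:~R * pi), e, 0).
Proof. by move=> e1; rewrite /pillow sin_int_pi mul0r acosK// in_itv. Qed.

End RationalTangles.

Theorem proposition3p1 (R : realType) (ms : seq move) :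
  tangle_invariant ms = Some 0 ->
  rational_tangle R ms = tangle_class (untangle R).
Proof.
move=> inv0; rewrite rational_tangle_word; congr tangle_class.
have [m11 [m12 [m21 [m22 [al [be [det inv hP]]]]]]] := word_pillow R ms.
have [[g [_ _ hn _ _]] hZ _] := cone_word R ms.
have m12_0 : m12 = 0.
  move: inv; rewrite inv0 /slope; case: eqP => // /eqP n0 [] /esym/eqP.
  by rewrite oppr_eq0 mulf_eq0 invr_eq0 !intr_eq0 (negbTE n0) orbF => /eqP.
have unit (x y : int) : x * y = 1 -> (x%:~R : R) = 1 \/ (x%:~R : R) = -1.
  move/(congr1 absz); rewrite abszM => /eqP; rewrite muln_eq1 => /andP[/eqP x1 _].
  by case: x x1 => [[|[|?]]|[|?]]// _; [left|right].
rewrite m12_0 mul0r subr0 in det hP.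
have u11 := unit _ _ det; have u22 : _ := unit m22 m11; rewrite mulrC in u22.
have {}u22 := u22 det.
(* [da] and [ep n] are the signs by which the word acts on the coordinates x
   and y of the strand over [X = n pi]. *)
have cosu (x : int) (z : R) : (x%:~R : R) = 1 \/ (x%:~R : R) = -1 -> cos (x%:~R * z) = cos z.
  by case=> ->; rewrite ?mul1r// mulN1r cosN.
pose da : R := cos (al%:~R * pi).
pose ep (n : int) : R := cos ((m21 * n)%:~R * pi) * cos (be%:~R * pi).
have ep1 n : ep n ^+ 2 = 1 by rewrite exprMn !cos_int_pi mulr1.
have da1 : da ^+ 2 = 1 by exact: cos_int_pi.
have key (n : int) (e : R) : -1 <= e <= 1 ->
    word_map ms (rt2 R *: (cos (n%:~R * pi), e, 0)) =
    rt2 R *: (cos (n%:~R * pi) * da, e * ep n, 0).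
  move=> e1; have r0 := rt2_gt0 R; rewrite hZ//.
  have [l l0 lE] := hP (n%:~R * pi) (acos e).
  rewrite (pillow_strand _ e1) in lE.
  have E : pillow (m11%:~R * (n%:~R * pi) + 0%:~R * acos e + al%:~R * pi)
      (m21%:~R * (n%:~R * pi) + m22%:~R * acos e + be%:~R * pi) =
    (cos (n%:~R * pi) * da, e * ep n, 0).
    have s0 : sin (m11%:~R * (n%:~R * pi) + al%:~R * pi) = 0 :> R.
      rewrite sinD sin_int_pi mulr0 addr0.
      by case: u11 => ->; rewrite ?mul1r ?mulN1r ?sinN sin_int_pi ?oppr0 mul0r.
    rewrite mul0r addr0 /pillow s0 mul0r !cosD_int_pi (cosu _ _ u11).
    have -> : m21%:~R * (n%:~R * pi) + m22%:~R * acos e =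
        m22%:~R * acos e + (m21 * n)%:~R * pi :> R by rewrite rmorphM; ring.
    by rewrite cosD_int_pi (cosu _ _ u22) acosK ?in_itv// mulrA.
  have := hn (cos (n%:~R * pi), e, 0); rewrite lE E enormZ gtr0_norm// !enorm_planar.
  rewrite [(_ * da) ^+ 2]exprMn [(e * ep n) ^+ 2]exprMn !cos_int_pi ?da1 ep1 !mulr1 => nl.
  (* The word preserves norms, and the sign changes do as well. *)
  have l1 : l = 1.
    have e2 := sqr_ge0 e.
    have s0 : Num.sqrt (1 + e ^+ 2) != 0 by rewrite gt_eqF// sqrtr_gt0; lra.
    by apply: (mulIf s0); rewrite nl mul1r.
  by rewrite l1 scale1r.
have sgnE (a : R) : a ^+ 2 = 1 -> exists n : int, a = cos (n%:~R * pi).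
  case/sqr1P => ->; first by exists 0; rewrite mul0r cos0.
  by exists 1; rewrite mul1r cospi.
have le1M (x e : R) : x ^+ 2 = 1 -> -1 <= e <= 1 -> -1 <= e * x <= 1.
  by case/sqr1P => ->; rewrite ?mulr1// mulrN1; case/andP => ? ?; apply/andP; split; lra.
rewrite untangleE; apply/seteqP; split=> v.
  move=> [_ [a [e [/sgnE[n ->] e1 ->]]] <-]; rewrite key//.
  exists (cos (n%:~R * pi) * da), (e * ep n); split=> //; last exact: le1M.
  by rewrite exprMn cos_int_pi da1 mulr1.
move=> [a [e [a1 e1 ->]]].
have [|n ne] := sgnE (a * da); first by rewrite exprMn a1 da1 mulr1.
exists (rt2 R *: (a * da, e * ep n, 0)).
  exists (a * da), (e * ep n); split=> //; last exact: le1M.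
  by rewrite exprMn a1 da1 mulr1.
rewrite ne key; last exact: le1M.
have da2 (x : R) : x * da * da = x by rewrite -mulrA -expr2 da1 mulr1.
have ep2 (x : R) : x * ep n * ep n = x by rewrite -mulrA -expr2 ep1 mulr1.
by rewrite -ne da2 ep2.
Qed.
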